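(* The translation $(-)^\ast$ defined in the context is a compatible translation of $\mathbf{HA}^\omega + \mathbf{iRC!}_{\mathbf{N},\mathbf{N}}$ in Martin-Löf type theory MLTT. That is, whenever a formula $\phi$, with free variables among $x_1^{\sigma_1},\dots,x_n^{\sigma_n}$, is derivable in $\mathbf{HA}^\omega + \mathbf{iRC!}_{\mathbf{N},\mathbf{N}}$, there is a term of type $\phi^\ast$ in MLTT in the context $x_1:\sigma_1^\ast,\dots,x_n:\sigma_n^\ast$.
   Context: Finite types: $\mathbf{N}$ is a finite type, and if $\sigma,\tau$ are finite types then so are $\sigma\to\tau$ and $\sigma\times\tau$. $\mathbf{HA}^\omega$ (Heyting arithmetic in all finite types) is the many-sorted intuitionistic first-order theory with countably many variables $x^\sigma,y^\sigma,\dots$ for each finite type $\sigma$, an equality predicate $=_\sigma$ for each type, application operators, and constants for zero, successor, recursors, pairing, projections, and the combinators $\mathbf{k}$ and $\mathbf{s}$. Its axioms are those of many-sorted intuitionistic predicate logic with equality, congruence rules for equality, the usual axioms for zero and successor, the induction scheme for all formulas, and the defining equations of the constants. $\exists! y^\tau\,\phi(x,y)$ abbreviates $\exists y^\tau\phi(x,y)\land\forall y_1^\tau\forall y_2^\tau(\phi(x,y_1)\land\phi(x,y_2)\supset y_1=_\tau y_2)$, where $\supset$ is implication. $\mathbf{iRC!}_{\mathbf{N},\mathbf{N}}$ is the rule: if $\forall x^{\mathbf{N}}\exists! y^{\mathbf{N}}\,\phi(x,y)$ is derivable, then $\exists f^{\mathbf{N}\to\mathbf{N}}\forall x^{\mathbf{N}}\,\phi(x,fx)$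 is derivable; in the extended theory it applies to everything derivable in that theory. MLTT is intensional Martin-Löf type theory with the empty type $N_0$, unit type, natural numbers $\mathbb{N}$, disjoint sums $+$, $\Pi$-types, $\Sigma$-types, identity types $\mathsf{Id}$ and universes $U_0,U_1,\dots$. A translation of one theory into another is called compatible if it preserves the meaning of logical and set-theoretical constructors, so that a proof of a theorem of the first theory is transported to a proof of its translation. The translation $(-)^\ast$: on types, $\mathbf{N}^\ast :\equiv \mathbb{N}$, $(\sigma\to\tau)^\ast :\equiv \sigma^\ast\to\tau^\ast$, $(\sigma\times\tau)^\ast :\equiv \sigma^\ast\times\tau^\ast$. Variables of type $\sigma$ go to variables of type $\sigma^\ast$, application terms to application terms, and constants to the corresponding terms of MLTT (e.g. $\mathbf{k}^\ast:\equiv\lambda x.\lambda y.x:\sigma^\ast\to(\tau^\ast\to\sigma^\ast)$). Formulas are sent to types by propositions-as-types: $=_\sigma$ to the identity type of $\sigma^\ast$, falsum to $N_0$, $\land$ to $\times$, $\lor$ to $+$, $\supset$ to $\to$, $(\forall x^\sigma\phi)^\ast:\equiv\Pi_{(x:\sigma^\ast)}\phi^\ast(x)$ and $(\exists x^\sigma\phi)^\ast:\equiv\Sigma_{(x:\sigma^\ast)}\phi^\ast(x)$. *)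

(* Defs.v *)
From Stdlib Require Import List.
Import ListNotations.

Set Implicit Arguments.

(* Both calculi are presented with de Bruijn indices: the head of a context is
   the variable bound last.  The syntax of HA^omega is intrinsically scoped and
   sorted; that of MLTT is raw, with separate judgements. *)

(* ------------------------------------------------------------------------ *)

Module HAomega.

Inductive fty : Type :=
| N : fty
| Arr : fty -> fty -> fty
| Prd : fty -> fty -> fty.

Inductive const : fty -> Type :=
| cZero : const N
| cSucc : const (Arr N N)
| cRec s : const (Arr s (Arr (Arr s (Arr N s)) (Arr N s)))
| cPair s t : const (Arr s (Arr t (Prd s t)))
| cFst s t : const (Arr (Prd s t) s)
| cSnd s t : const (Arr (Prd s t) t)
| cK s t : const (Arr s (Arr t s))
| cS r s t : const (Arr (Arr r (Arr s t)) (Arr (Arr r s) (Arr r t))).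

Inductive var : list fty -> fty -> Type :=
| vz G s : var (s :: G) s
| vs G s t : var G s -> var (t :: G) s.

Arguments vz {G s}.
Arguments vs {G s t} _.

Inductive tm (G : list fty) : fty -> Type :=
| Var s : var G s -> tm G s
| Cst s : const s -> tm G s
| App s t : tm G (Arr s t) -> tm G s -> tm G t.

Arguments Var {G s} _.
Arguments Cst {G s} _.
Arguments App {G s t} _ _.

Inductive form (G : list fty) : Type :=
| Bot : form G
| Eq s : tm G s -> tm G s -> form G
| And : form G -> form G -> form G
| Or : form G -> form G -> form G
| Imp : form G -> form G -> form G
| All s : form (s :: G) -> form G
| Ex s : form (s :: G) -> form G.

Arguments Bot {G}.
Arguments All {G} s _.
Arguments Ex {G} s _.

Definition subst (G D : list fty) : Type := forall s, var G s -> tm D s.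

Fixpoint subst_tm {G D} (f : subst G D) {s} (a : tm G s) : tm D s :=
  match a with
  | Var x => f _ x
  | Cst c => Cst c
  | App a b => App (subst_tm f a) (subst_tm f b)
  end.

Definition scons {G D s} (a : tm D s) (f : subst G D) : subst (s :: G) D :=
  fun t x =>
    match x in var (s' :: G') t' return tm D s' -> subst G' D -> tm D t' with
    | vz => fun a _ => a
    | vs y => fun _ f => f _ y
    end a f.

Definition ids {G} : subst G G := fun _ x => Var x.
Definition shift {G t} : subst G (t :: G) := fun _ x => Var (vs x).

Definition up {G D s} (f : subst G D) : subst (s :: G) (s :: D) :=
  scons (Var vz) (fun _ x => subst_tm shift (f _ x)).

Fixpoint subst_form {G D} (f : subst G D) (p : form G) : form D :=
  match p with
  | Bot => Bot
  | Eq a b => Eq (subst_tm f a) (subst_tm f b)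
  | And p q => And (subst_form f p) (subst_form f q)
  | Or p q => Or (subst_form f p) (subst_form f q)
  | Imp p q => Imp (subst_form f p) (subst_form f q)
  | All s p => All s (subst_form (up f) p)
  | Ex s p => Ex s (subst_form (up f) p)
  end.

Definition inst {G s} (p : form (s :: G)) (a : tm G s) : form G :=
  subst_form (scons a ids) p.
Definition weak {G s} (p : form G) : form (s :: G) := subst_form shift p.

Definition zero {G} : tm G N := Cst cZero.
Definition succ {G} (a : tm G N) : tm G N := App (Cst cSucc) a.

(* p(S x), for p(x) with x the last variable of its context *)
Definition inst_succ {G} (p : form (N :: G)) : form (N :: G) :=
  subst_form (scons (succ (Var vz)) shift) p.

(* exists! y. p(y)  :=
   exists y. p(y)  /\  forall y1 y2. p(y1) /\ p(y2) -> y1 = y2 *)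
Definition ExUnique {G} (t : fty) (p : form (t :: G)) : form G :=
  let wk2 : subst G (t :: t :: G) := fun _ x => Var (vs (vs x)) in
  And (Ex t p)
    (All t (All t
       (Imp (And (subst_form (scons (Var (vs vz)) wk2) p)
                 (subst_form (scons (Var vz) wk2) p))
            (Eq (Var (vs vz)) (Var vz))))).

(* forall x. p(x, f x) in the context extended by f, for p in the context
   extended by x and then y *)
Definition AllApp {G} (s t : fty) (p : form (t :: s :: G))
  : form (Arr s t :: G) :=
  All s (subst_form
           (scons (App (Var (vs vz)) (Var vz))
             (scons (Var vz) (fun _ x => Var (vs (vs x))))) p).

(* Hilbert-style axioms.  Equality has reflexivity and replacement, from which
   symmetry, transitivity and the congruence of application follow. *)
Inductive axiom (G : list fty) : form G -> Prop :=
| ax_k p q : axiom (Imp p (Imp q p))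
| ax_s p q r : axiom (Imp (Imp p (Imp q r)) (Imp (Imp p q) (Imp p r)))
| ax_conj p q : axiom (Imp p (Imp q (And p q)))
| ax_proj1 p q : axiom (Imp (And p q) p)
| ax_proj2 p q : axiom (Imp (And p q) q)
| ax_inl p q : axiom (Imp p (Or p q))
| ax_inr p q : axiom (Imp q (Or p q))
| ax_case p q r : axiom (Imp (Imp p r) (Imp (Imp q r) (Imp (Or p q) r)))
| ax_efq p : axiom (Imp Bot p)
| ax_all s (p : form (s :: G)) a : axiom (Imp (All s p) (inst p a))
| ax_ex s (p : form (s :: G)) a : axiom (Imp (inst p a) (Ex s p))
| ax_refl s (a : tm G s) : axiom (Eq a a)
| ax_repl s (a b : tm G s) (p : form (s :: G)) :
    axiom (Imp (Eq a b) (Imp (inst p a) (inst p b)))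
| ax_succ_zero (a : tm G N) : axiom (Imp (Eq (succ a) zero) Bot)
| ax_succ_inj (a b : tm G N) : axiom (Imp (Eq (succ a) (succ b)) (Eq a b))
| ax_ind (p : form (N :: G)) :
    axiom (Imp (And (inst p zero) (All N (Imp p (inst_succ p)))) (All N p))
| ax_rec0 s (a : tm G s) b :
    axiom (Eq (App (App (App (Cst (cRec s)) a) b) zero) a)
| ax_recS s (a : tm G s) b n :
    axiom (Eq (App (App (App (Cst (cRec s)) a) b) (succ n))
              (App (App b (App (App (App (Cst (cRec s)) a) b) n)) n))
| ax_fst s t (a : tm G s) (b : tm G t) :
    axiom (Eq (App (Cst (cFst s t)) (App (App (Cst (cPair s t)) a) b)) a)
| ax_snd s t (a : tm G s) (b : tm G t) :
    axiom (Eq (App (Cst (cSnd s t)) (App (App (Cst (cPair s t)) a) b)) b)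
| ax_pair s t (c : tm G (Prd s t)) :
    axiom (Eq (App (App (Cst (cPair s t)) (App (Cst (cFst s t)) c))
                   (App (Cst (cSnd s t)) c)) c)
| ax_K s t (a : tm G s) (b : tm G t) :
    axiom (Eq (App (App (Cst (cK s t)) a) b) a)
| ax_S r s t (a : tm G (Arr r (Arr s t))) (b : tm G (Arr r s)) (c : tm G r) :
    axiom (Eq (App (App (App (Cst (cS r s t)) a) b) c)
              (App (App a c) (App b c))).

(* HA^omega + iRC!_{N,N}: the formulas with free variables in G that are
   theorems.  As every finite type has a closed term, a derivation that uses
   further free variables can be turned into one that does not, by
   generalization and instantiation. *)
Inductive derivable_iRC : forall G : list fty, form G -> Prop :=
| d_axiom G (p : form G) : axiom p -> derivable_iRC p
| d_mp G (p q : form G) :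
    derivable_iRC (Imp p q) -> derivable_iRC p -> derivable_iRC q
| d_all G s (q : form G) (p : form (s :: G)) :
    derivable_iRC (Imp (weak q) p) -> derivable_iRC (Imp q (All s p))
| d_ex G s (p : form (s :: G)) (q : form G) :
    derivable_iRC (Imp p (weak q)) -> derivable_iRC (Imp (Ex s p) q)
| d_iRC G (p : form (N :: N :: G)) :
    derivable_iRC (All N (ExUnique p)) ->
    derivable_iRC (Ex (Arr N N) (AllApp p)).

End HAomega.

(* ------------------------------------------------------------------------ *)

(* Cumulative universes a la Russell: a type is an element of some U_i.  There
   are no judgemental eta rules. *)
Module MLTT.

(* Number of variables bound in each argument: Pi, Sig: 0,1; lam: 1;
   natrec d e t: 0,2,0; case d e t: 1,1,0; split d t: 2,0; idrec d t: 1,0. *)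
Inductive term : Type :=
| Var : nat -> term
| Univ : nat -> term
| Empty : term
| Unit : term
| Nat : term
| Sum : term -> term -> term
| Pi : term -> term -> term
| Sig : term -> term -> term
| Id : term -> term -> term -> term
| emptyrec : term -> term
| star : term
| unitrec : term -> term -> term
| zero : term
| succ : term -> term
| natrec : term -> term -> term -> term
| inl : term -> term
| inr : term -> term
| case : term -> term -> term -> term
| lam : term -> term
| app : term -> term -> term
| pair : term -> term -> term
| split : term -> term -> term
| refl : term -> term
| idrec : term -> term -> term.

Definition up_ren (f : nat -> nat) (n : nat) : nat :=
  match n with O => O | S n => S (f n) end.

Fixpoint ren (f : nat -> nat) (t : term) : term :=
  match t with
  | Var n => Var (f n)
  | Univ i => Univ i
  | Empty => Empty
  | Unit => Unit
  | Nat => Nat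
  | Sum A B => Sum (ren f A) (ren f B)
  | Pi A B => Pi (ren f A) (ren (up_ren f) B)
  | Sig A B => Sig (ren f A) (ren (up_ren f) B)
  | Id A a b => Id (ren f A) (ren f a) (ren f b)
  | emptyrec t => emptyrec (ren f t)
  | star => star
  | unitrec d t => unitrec (ren f d) (ren f t)
  | zero => zero
  | succ t => succ (ren f t)
  | natrec d e t => natrec (ren f d) (ren (up_ren (up_ren f)) e) (ren f t)
  | inl t => inl (ren f t)
  | inr t => inr (ren f t)
  | case d e t => case (ren (up_ren f) d) (ren (up_ren f) e) (ren f t)
  | lam b => lam (ren (up_ren f) b)
  | app t u => app (ren f t) (ren f u)
  | pair a b => pair (ren f a) (ren f b)
  | split d t => split (ren (up_ren (up_ren f)) d) (ren f t)
  | refl a => refl (ren f a)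
  | idrec d t => idrec (ren (up_ren f) d) (ren f t)
  end.

Definition shift : term -> term := ren S.

Definition scons (a : term) (f : nat -> term) (n : nat) : term :=
  match n with O => a | S n => f n end.

Definition up (f : nat -> term) : nat -> term :=
  scons (Var 0) (fun n => shift (f n)).

Fixpoint subst (f : nat -> term) (t : term) : term :=
  match t with
  | Var n => f n
  | Univ i => Univ i
  | Empty => Empty
  | Unit => Unit
  | Nat => Nat
  | Sum A B => Sum (subst f A) (subst f B)
  | Pi A B => Pi (subst f A) (subst (up f) B)
  | Sig A B => Sig (subst f A) (subst (up f) B)
  | Id A a b => Id (subst f A) (subst f a) (subst f b)
  | emptyrec t => emptyrec (subst f t)
  | star => star
  | unitrec d t => unitrec (subst f d) (subst f t)
  | zero => zero
  | succ t => succ (subst f t)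
  | natrec d e t => natrec (subst f d) (subst (up (up f)) e) (subst f t)
  | inl t => inl (subst f t)
  | inr t => inr (subst f t)
  | case d e t => case (subst (up f) d) (subst (up f) e) (subst f t)
  | lam b => lam (subst (up f) b)
  | app t u => app (subst f t) (subst f u)
  | pair a b => pair (subst f a) (subst f b)
  | split d t => split (subst (up (up f)) d) (subst f t)
  | refl a => refl (subst f a)
  | idrec d t => idrec (subst (up f) d) (subst f t)
  end.

Definition inst (t a : term) : term := subst (scons a Var) t.
(* t(a, b), with b for the variable bound last *)
Definition inst2 (t a b : term) : term := subst (scons b (scons a Var)) t.
Definition inst3 (t a b c : term) : term :=
  subst (scons c (scons b (scons a Var))) t.

(* C(a) in a context extended by one, respectively two, variables beyond the
   parameters of C *)
Definition inst_wk1 (C a : term) : term :=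
  subst (scons a (fun n => Var (S n))) C.
Definition inst_wk2 (C a : term) : term :=
  subst (scons a (fun n => Var (S (S n)))) C.

(* context of the motive of identity elimination: x : A, y : A, z : Id A x y *)
Definition id_ctx (G : list term) (A : term) : list term :=
  Id (shift (shift A)) (Var 1) (Var 0) :: shift A :: A :: G.

(* C(x, x, refl x), with x the last variable *)
Definition inst_refl (C : term) : term :=
  subst (scons (refl (Var 0)) (scons (Var 0) (scons (Var 0)
          (fun n => Var (S n))))) C.

Inductive lookup : list term -> nat -> term -> Prop :=
| lookup_here G A : lookup (A :: G) 0 (shift A)
| lookup_there G A B n : lookup G n A -> lookup (B :: G) (S n) (shift A).

Inductive wf : list term -> Prop :=
| wf_nil : wf []
| wf_cons G A i : wf G -> has_type G A (Univ i) -> wf (A :: G)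

with has_type : list term -> term -> term -> Prop :=
| t_var G n A : wf G -> lookup G n A -> has_type G (Var n) A
| t_conv G t A B i :
    has_type G t A -> conv G A B (Univ i) -> has_type G t B

| t_univ G i : wf G -> has_type G (Univ i) (Univ (S i))
| t_cumul G A i : has_type G A (Univ i) -> has_type G A (Univ (S i))
| t_Empty G i : wf G -> has_type G Empty (Univ i)
| t_Unit G i : wf G -> has_type G Unit (Univ i)
| t_Nat G i : wf G -> has_type G Nat (Univ i)
| t_Sum G A B i :
    has_type G A (Univ i) -> has_type G B (Univ i) ->
    has_type G (Sum A B) (Univ i)
| t_Pi G A B i :
    has_type G A (Univ i) -> has_type (A :: G) B (Univ i) ->
    has_type G (Pi A B) (Univ i)
| t_Sig G A B i :
    has_type G A (Univ i) -> has_type (A :: G) B (Univ i) ->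
    has_type G (Sig A B) (Univ i)
| t_Id G A a b i :
    has_type G A (Univ i) -> has_type G a A -> has_type G b A ->
    has_type G (Id A a b) (Univ i)

| t_emptyrec G C t j :
    has_type (Empty :: G) C (Univ j) -> has_type G t Empty ->
    has_type G (emptyrec t) (inst C t)

| t_star G : wf G -> has_type G star Unit
| t_unitrec G C d t j :
    has_type (Unit :: G) C (Univ j) ->
    has_type G d (inst C star) -> has_type G t Unit ->
    has_type G (unitrec d t) (inst C t)

| t_zero G : wf G -> has_type G zero Nat
| t_succ G t : has_type G t Nat -> has_type G (succ t) Nat
| t_natrec G C d e t j :
    has_type (Nat :: G) C (Univ j) ->
    has_type G d (inst C zero) ->
    has_type (C :: Nat :: G) e (inst_wk2 C (succ (Var 1))) ->
    has_type G t Nat ->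
    has_type G (natrec d e t) (inst C t)

| t_inl G A B a i :
    has_type G A (Univ i) -> has_type G B (Univ i) -> has_type G a A ->
    has_type G (inl a) (Sum A B)
| t_inr G A B b i :
    has_type G A (Univ i) -> has_type G B (Univ i) -> has_type G b B ->
    has_type G (inr b) (Sum A B)
| t_case G A B C d e t i j :
    has_type G A (Univ i) -> has_type G B (Univ i) ->
    has_type (Sum A B :: G) C (Univ j) ->
    has_type (A :: G) d (inst_wk1 C (inl (Var 0))) ->
    has_type (B :: G) e (inst_wk1 C (inr (Var 0))) ->
    has_type G t (Sum A B) ->
    has_type G (case d e t) (inst C t)

| t_lam G A B b i :
    has_type G A (Univ i) -> has_type (A :: G) B (Univ i) ->
    has_type (A :: G) b B ->
    has_type G (lam b) (Pi A B)
| t_app G A B t a i :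
    has_type G A (Univ i) -> has_type (A :: G) B (Univ i) ->
    has_type G t (Pi A B) -> has_type G a A ->
    has_type G (app t a) (inst B a)

| t_pair G A B a b i :
    has_type G A (Univ i) -> has_type (A :: G) B (Univ i) ->
    has_type G a A -> has_type G b (inst B a) ->
    has_type G (pair a b) (Sig A B)
| t_split G A B C d t i j :
    has_type G A (Univ i) -> has_type (A :: G) B (Univ i) ->
    has_type (Sig A B :: G) C (Univ j) ->
    has_type (B :: A :: G) d (inst_wk2 C (pair (Var 1) (Var 0))) ->
    has_type G t (Sig A B) ->
    has_type G (split d t) (inst C t)

| t_refl G A a i :
    has_type G A (Univ i) -> has_type G a A ->
    has_type G (refl a) (Id A a a)
| t_idrec G A C d a b t i j :
    has_type G A (Univ i) -> has_type G a A -> has_type G b A ->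
    has_type (id_ctx G A) C (Univ j) ->
    has_type (A :: G) d (inst_refl C) ->
    has_type G t (Id A a b) ->
    has_type G (idrec d t) (inst3 C a b t)

(* conv G t u A : judgemental equality of t and u at type A *)
with conv : list term -> term -> term -> term -> Prop :=
| c_refl G t A : has_type G t A -> conv G t t A
| c_sym G t u A : conv G t u A -> conv G u t A
| c_trans G t u v A : conv G t u A -> conv G u v A -> conv G t v A
| c_conv G t u A B i :
    conv G t u A -> conv G A B (Univ i) -> conv G t u B
| c_cumul G A B i : conv G A B (Univ i) -> conv G A B (Univ (S i))

| c_Sum G A A' B B' i :
    conv G A A' (Univ i) -> conv G B B' (Univ i) ->
    conv G (Sum A B) (Sum A' B') (Univ i)
| c_Pi G A A' B B' i :
    has_type G A (Univ i) ->
    conv G A A' (Univ i) -> conv (A :: G) B B' (Univ i) ->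
    conv G (Pi A B) (Pi A' B') (Univ i)
| c_Sig G A A' B B' i :
    has_type G A (Univ i) ->
    conv G A A' (Univ i) -> conv (A :: G) B B' (Univ i) ->
    conv G (Sig A B) (Sig A' B') (Univ i)
| c_Id G A A' a a' b b' i :
    conv G A A' (Univ i) -> conv G a a' A -> conv G b b' A ->
    conv G (Id A a b) (Id A' a' b') (Univ i)

| c_emptyrec G C t t' j :
    has_type (Empty :: G) C (Univ j) -> conv G t t' Empty ->
    conv G (emptyrec t) (emptyrec t') (inst C t)

| c_unitrec G C d d' t t' j :
    has_type (Unit :: G) C (Univ j) ->
    conv G d d' (inst C star) -> conv G t t' Unit ->
    conv G (unitrec d t) (unitrec d' t') (inst C t)
| c_unitrec_star G C d j :
    has_type (Unit :: G) C (Univ j) -> has_type G d (inst C star) ->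
    conv G (unitrec d star) d (inst C star)

| c_succ G t t' : conv G t t' Nat -> conv G (succ t) (succ t') Nat
| c_natrec G C d d' e e' t t' j :
    has_type (Nat :: G) C (Univ j) ->
    conv G d d' (inst C zero) ->
    conv (C :: Nat :: G) e e' (inst_wk2 C (succ (Var 1))) ->
    conv G t t' Nat ->
    conv G (natrec d e t) (natrec d' e' t') (inst C t)
| c_natrec_zero G C d e j :
    has_type (Nat :: G) C (Univ j) ->
    has_type G d (inst C zero) ->
    has_type (C :: Nat :: G) e (inst_wk2 C (succ (Var 1))) ->
    conv G (natrec d e zero) d (inst C zero)
| c_natrec_succ G C d e t j :
    has_type (Nat :: G) C (Univ j) ->
    has_type G d (inst C zero) ->
    has_type (C :: Nat :: G) e (inst_wk2 C (succ (Var 1))) ->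
    has_type G t Nat ->
    conv G (natrec d e (succ t)) (inst2 e t (natrec d e t)) (inst C (succ t))

| c_inl G A B a a' i :
    has_type G A (Univ i) -> has_type G B (Univ i) -> conv G a a' A ->
    conv G (inl a) (inl a') (Sum A B)
| c_inr G A B b b' i :
    has_type G A (Univ i) -> has_type G B (Univ i) -> conv G b b' B ->
    conv G (inr b) (inr b') (Sum A B)
| c_case G A B C d d' e e' t t' i j :
    has_type G A (Univ i) -> has_type G B (Univ i) ->
    has_type (Sum A B :: G) C (Univ j) ->
    conv (A :: G) d d' (inst_wk1 C (inl (Var 0))) ->
    conv (B :: G) e e' (inst_wk1 C (inr (Var 0))) ->
    conv G t t' (Sum A B) ->
    conv G (case d e t) (case d' e' t') (inst C t)
| c_case_inl G A B C d e a i j :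
    has_type G A (Univ i) -> has_type G B (Univ i) ->
    has_type (Sum A B :: G) C (Univ j) ->
    has_type (A :: G) d (inst_wk1 C (inl (Var 0))) ->
    has_type (B :: G) e (inst_wk1 C (inr (Var 0))) ->
    has_type G a A ->
    conv G (case d e (inl a)) (inst d a) (inst C (inl a))
| c_case_inr G A B C d e b i j :
    has_type G A (Univ i) -> has_type G B (Univ i) ->
    has_type (Sum A B :: G) C (Univ j) ->
    has_type (A :: G) d (inst_wk1 C (inl (Var 0))) ->
    has_type (B :: G) e (inst_wk1 C (inr (Var 0))) ->
    has_type G b B ->
    conv G (case d e (inr b)) (inst e b) (inst C (inr b))

| c_lam G A B b b' i :
    has_type G A (Univ i) -> has_type (A :: G) B (Univ i) ->
    conv (A :: G) b b' B ->
    conv G (lam b) (lam b') (Pi A B)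
| c_app G A B t t' a a' i :
    has_type G A (Univ i) -> has_type (A :: G) B (Univ i) ->
    conv G t t' (Pi A B) -> conv G a a' A ->
    conv G (app t a) (app t' a') (inst B a)
| c_beta G A B b a i :
    has_type G A (Univ i) -> has_type (A :: G) B (Univ i) ->
    has_type (A :: G) b B -> has_type G a A ->
    conv G (app (lam b) a) (inst b a) (inst B a)

| c_pair G A B a a' b b' i :
    has_type G A (Univ i) -> has_type (A :: G) B (Univ i) ->
    conv G a a' A -> conv G b b' (inst B a) ->
    conv G (pair a b) (pair a' b') (Sig A B)
| c_split G A B C d d' t t' i j :
    has_type G A (Univ i) -> has_type (A :: G) B (Univ i) ->
    has_type (Sig A B :: G) C (Univ j) ->
    conv (B :: A :: G) d d' (inst_wk2 C (pair (Var 1) (Var 0))) ->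
    conv G t t' (Sig A B) ->
    conv G (split d t) (split d' t') (inst C t)
| c_split_pair G A B C d a b i j :
    has_type G A (Univ i) -> has_type (A :: G) B (Univ i) ->
    has_type (Sig A B :: G) C (Univ j) ->
    has_type (B :: A :: G) d (inst_wk2 C (pair (Var 1) (Var 0))) ->
    has_type G a A -> has_type G b (inst B a) ->
    conv G (split d (pair a b)) (inst2 d a b) (inst C (pair a b))

| c_refl_cong G A a a' i :
    has_type G A (Univ i) -> conv G a a' A ->
    conv G (refl a) (refl a') (Id A a a)
| c_idrec G A C d d' a b t t' i j :
    has_type G A (Univ i) -> has_type G a A -> has_type G b A ->
    has_type (id_ctx G A) C (Univ j) ->
    conv (A :: G) d d' (inst_refl C) ->
    conv G t t' (Id A a b) ->
    conv G (idrec d t) (idrec d' t') (inst3 C a b t)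
| c_idrec_refl G A C d a i j :
    has_type G A (Univ i) -> has_type G a A ->
    has_type (id_ctx G A) C (Univ j) ->
    has_type (A :: G) d (inst_refl C) ->
    conv G (idrec d (refl a)) (inst d a) (inst3 C a a (refl a)).

Definition arrow (A B : term) : term := Pi A (shift B).
Definition prod (A B : term) : term := Sig A (shift B).

End MLTT.

(* ------------------------------------------------------------------------ *)

Fixpoint tr_ty (s : HAomega.fty) : MLTT.term :=
  match s with
  | HAomega.N => MLTT.Nat
  | HAomega.Arr s t => MLTT.arrow (tr_ty s) (tr_ty t)
  | HAomega.Prd s t => MLTT.prod (tr_ty s) (tr_ty t)
  end.

Definition tr_ctx (G : list HAomega.fty) : list MLTT.term := map tr_ty G.

Fixpoint tr_var {G s} (x : HAomega.var G s) : nat :=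
  match x with
  | HAomega.vz => 0
  | HAomega.vs x => S (tr_var x)
  end.

Definition tr_const {s} (c : HAomega.const s) : MLTT.term :=
  let v := MLTT.Var in
  match c with
  | HAomega.cZero => MLTT.zero
  | HAomega.cSucc => MLTT.lam (MLTT.succ (v 0))
  | HAomega.cRec _ => (* \a b n. natrec a ((m, r). b r m) n *)
      MLTT.lam (MLTT.lam (MLTT.lam
        (MLTT.natrec (v 2) (MLTT.app (MLTT.app (v 3) (v 0)) (v 1)) (v 0))))
  | HAomega.cPair _ _ => MLTT.lam (MLTT.lam (MLTT.pair (v 1) (v 0)))
  | HAomega.cFst _ _ => MLTT.lam (MLTT.split (v 1) (v 0))
  | HAomega.cSnd _ _ => MLTT.lam (MLTT.split (v 0) (v 0))
  | HAomega.cK _ _ => MLTT.lam (MLTT.lam (v 1))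
  | HAomega.cS _ _ _ =>
      MLTT.lam (MLTT.lam (MLTT.lam
        (MLTT.app (MLTT.app (v 2) (v 0)) (MLTT.app (v 1) (v 0)))))
  end.

Fixpoint tr_tm {G s} (a : HAomega.tm G s) : MLTT.term :=
  match a with
  | HAomega.Var x => MLTT.Var (tr_var x)
  | HAomega.Cst c => tr_const c
  | HAomega.App a b => MLTT.app (tr_tm a) (tr_tm b)
  end.

Fixpoint tr_form {G} (p : HAomega.form G) : MLTT.term :=
  match p with
  | HAomega.Bot => MLTT.Empty
  | @HAomega.Eq _ s a b => MLTT.Id (tr_ty s) (tr_tm a) (tr_tm b)
  | HAomega.And p q => MLTT.prod (tr_form p) (tr_form q)
  | HAomega.Or p q => MLTT.Sum (tr_form p) (tr_form q)
  | HAomega.Imp p q => MLTT.arrow (tr_form p) (tr_form q)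
  | HAomega.All s p => MLTT.Pi (tr_ty s) (tr_form p)
  | HAomega.Ex s p => MLTT.Sig (tr_ty s) (tr_form p)
  end.

(* Main.v *)
Require Import Defs.
From Stdlib Require Import List.
Import MLTT.

(* Under propositions-as-types the axioms of intuitionistic logic and of
   arithmetic are inhabited by the introduction and elimination rules of MLTT:
   replacement by the eliminator of identity types, induction by [natrec],
   [succ x <> 0] by large elimination.  The rule iRC! holds because MLTT proves
   the axiom of choice: from a term of type [forall x, exists y, P(x, y)] the
   first projection is a choice function, so that the uniqueness of [y] plays
   no role.  The translations of the equations between constants hold
   judgementally, except for surjective pairing, which is propositional. *)

(** * Substitution calculus *)

(** Soundness asks only that some term exists, so most proofs compose admissible rules for
    inhabitation, [inh], instead of writing terms down. The friction comes from the constants: they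
    are translated as closed lambda terms, while the rules of MLTT speak of the raw [succ] and
    [pair], so that an axiom and the rule proving it can differ by a beta step inside a dependent
    type. To conclude from [a] and [b] being convertible that [inst C a] and [inst C b] are would
    require a functionality lemma, a further induction over derivations. This is avoided by
    internalizing the conversion as an identity type, for which a single congruence rule suffices,
    and transporting along it. The price is a transport inside the term found, which is harmless
    since only existence is claimed. The metatheory of typing thereby reduces to little more than
    one substitution lemma. *)

Lemma subst_ext f g t : (forall n, f n = g n) -> subst f t = subst g t.
Proof.
  assert (U : forall f g, (forall n, f n = g n) -> forall n, up f n = up g n).
  { intros f' g' E [|n]; cbn; [|rewrite E]; reflexivity. }
  revert f g; induction t; intros f g E; cbn; f_equal; auto 6.
Qed.

Lemma ren_subst f t : ren f t = subst (fun n => Var (f n)) t.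
Proof.
  assert (U : forall f n, Var (up_ren f n) = up (fun n => Var (f n)) n)
    by (intros f' [|n]; reflexivity).
  assert (U2 : forall f n,
             Var (up_ren (up_ren f) n) = up (up (fun n => Var (f n))) n)
    by (intros f' [|[|n]]; reflexivity).
  revert f; induction t; intros f; cbn; f_equal; auto;
    match goal with H : forall f, ren f ?t = _ |- ren _ ?t = _ => rewrite H end;
    apply subst_ext; auto.
Qed.

Lemma subst_id f t : (forall n, f n = Var n) -> subst f t = t.
Proof.
  assert (U : forall f, (forall n, f n = Var n) -> forall n, up f n = Var n).
  { intros f' E [|n]; cbn; [|rewrite E]; reflexivity. }
  revert f; induction t; intros f E; cbn; f_equal; auto 6.
Qed.

Lemma subst_ren g f t : subst g (ren f t) = subst (fun n => g (f n)) t.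
Proof.
  assert (U : forall g f n, up g (up_ren f n) = up (fun n => g (f n)) n)
    by (intros g' f' [|n]; reflexivity).
  assert (U2 : forall g f n, up (up g) (up_ren (up_ren f) n)
                             = up (up (fun n => g (f n))) n)
    by (intros g' f' [|[|n]]; reflexivity).
  revert g f; induction t; intros g f; cbn; f_equal; auto;
    match goal with
      H : forall g f, subst g (ren f ?t) = _ |- subst _ (ren _ ?t) = _ => rewrite H
    end; apply subst_ext; auto.
Qed.

(** [subst_subst] needs this commutation under binders. It rests on the composite of a substitution
    followed by a renaming ([R]), so the composites involving renamings have to be settled before
    those of two substitutions. *)
Lemma subst_shift f t : subst (up f) (shift t) = shift (subst f t).
Proof.
  assert (R : forall r f t, ren r (subst f t) = subst (fun n => ren r (f n)) t).
  { clear; intros r f t.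
    assert (S : forall r t, ren (up_ren r) (shift t) = shift (ren r t)).
    { intros r' t'; unfold shift.
      rewrite (ren_subst (up_ren r')), (ren_subst S (ren r' t')), !subst_ren.
      reflexivity. }
    assert (U : forall r f n, ren (up_ren r) (up f n) = up (fun n => ren r (f n)) n)
      by (intros r' f' [|n]; [reflexivity | apply S]).
    assert (U2 : forall r f n, ren (up_ren (up_ren r)) (up (up f) n)
                               = up (up (fun n => ren r (f n))) n)
      by (intros r' f' [|n];
          [reflexivity | cbn; rewrite S; f_equal; apply U]).
    revert r f; induction t; intros r f; cbn; f_equal; auto;
      match goal with
        H : forall r f, ren r (subst f ?t) = _ |- ren _ (subst _ ?t) = _ => rewrite H
      end; apply subst_ext; auto. }
  unfold shift; rewrite subst_ren, R; reflexivity.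
Qed.

Lemma subst_subst g f t : subst g (subst f t) = subst (fun n => subst g (f n)) t.
Proof.
  assert (U : forall g f n, subst (up g) (up f n) = up (fun n => subst g (f n)) n)
    by (intros g' f' [|n]; [reflexivity | apply subst_shift]).
  assert (U2 : forall g f n, subst (up (up g)) (up (up f) n)
                             = up (up (fun n => subst g (f n))) n)
    by (intros g' f' [|n];
        [reflexivity | cbn; rewrite subst_shift; f_equal; apply U]).
  revert g f; induction t; intros g f; cbn; f_equal; auto;
    match goal with
      H : forall g f, subst g (subst f ?t) = _ |- subst _ (subst _ ?t) = _ => rewrite H
    end; apply subst_ext; auto.
Qed.

(** Renamings become substitutions and composites are merged, so that each side carries a single
    substitution; these are compared pointwise, by cases on the index. [f_equal] is withheld when a
    side is itself a substitution, where it would ask for equality of functions. *)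
Ltac subst_step :=
  first
    [ reflexivity
    | progress (unfold inst, inst2, inst3, inst_wk1, inst_wk2, inst_refl, id_ctx,
                 arrow, prod, shift)
    | progress (rewrite ?ren_subst, ?subst_subst)
    | match goal with
      | |- context [up _ ?n] => is_var n; destruct n; cbn
      | |- context [scons _ _ ?n] => is_var n; destruct n; cbn
      | |- subst _ ?t = subst _ ?t => apply subst_ext; intros ?; cbn
      | |- subst _ ?t = ?t => apply subst_id; intros ?; cbn
      | |- ?t = subst _ ?t => symmetry
      end
    | progress cbn
    | match goal with
      | |- subst _ _ = _ => fail 1
      | |- _ = subst _ _ => fail 1
      | |- _ => f_equal
      end ].
Ltac subst_eq := intros; repeat subst_step.

Scheme wf_mut := Minimality for wf Sort Prop
with has_type_mut := Minimality for has_type Sort Prop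
with conv_mut := Minimality for conv Sort Prop.

Lemma has_type_eq G t A B : has_type G t A -> A = B -> has_type G t B.
Proof. intros H <-; exact H. Qed.

Lemma conv_eq G t u A t' u' A' :
  conv G t u A -> t = t' -> u = u' -> A = A' -> conv G t' u' A'.
Proof. intros H <- <- <-; exact H. Qed.

Lemma has_type_wf G t A : has_type G t A -> wf G.
Proof.
  revert G t A.
  apply (has_type_mut (fun _ => True) (fun G t A => wf G)
                      (fun G t u A => wf G)); auto.
Qed.

(** * The substitution lemma, parametric in the terms substituted *)

Section Substitution.

(* Instantiated with variables first, which gives weakening, and with
   arbitrary terms afterwards. *)
Variable Q : list term -> term -> term -> Prop.
Hypothesis Q_has_type : forall D t A, wf D -> Q D t A -> has_type D t A.
Hypothesis Q_var : forall D n A, wf D -> lookup D n A -> Q D (Var n) A.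
Hypothesis Q_shift : forall D B t A,
  wf (B :: D) -> Q D t A -> Q (B :: D) (shift t) (shift A).

(** [wf D] is included because the clause on variables says nothing about [D] when [G] is empty. *)
Definition subst_ok (D : list term) (f : nat -> term) (G : list term) : Prop :=
  wf D /\ forall n A, lookup G n A -> Q D (f n) (subst f A).

(** Crossing a binder is where [Q_shift] enters. For arbitrary terms it is weakening itself; for
    variables it is immediate, which is why these come first. *)
Lemma subst_ok_up D f G A i :
  subst_ok D f G -> has_type D (subst f A) (Univ i) ->
  subst_ok (subst f A :: D) (up f) (A :: G).
Proof.
  intros [W H] HA.
  assert (W' : wf (subst f A :: D)) by (econstructor; eauto).
  split; [exact W'|].
  intros n B L; inversion L; subst; rewrite subst_shift.
  - apply Q_var; [exact W' | constructor].
  - apply Q_shift; auto.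
Qed.

Lemma subst_ok_id_ctx D f G A i :
  (forall D f, subst_ok D f G -> has_type D (subst f A) (Univ i)) ->
  subst_ok D f G ->
  subst_ok (id_ctx D (subst f A)) (up (up (up f))) (id_ctx G A).
Proof.
  intros HA ok.
  assert (ok1 := subst_ok_up _ _ _ _ _ ok (HA _ _ ok)).
  assert (W1 := proj1 ok1).
  assert (shift_ok : forall D f B, wf (B :: D) -> subst_ok D f G ->
            subst_ok (B :: D) (fun n => shift (f n)) G).
  { intros D' f' B W [W' H]; split; [exact W|].
    intros n A' L; eapply eq_ind with (P := fun X => Q _ _ X);
      [apply Q_shift; [exact W | apply H, L] | subst_eq]. }
  assert (HA1 : has_type (subst f A :: D) (subst (up f) (shift A)) (Univ i)).
  { eapply eq_ind with (P := fun X => has_type _ X _);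
      [apply HA, shift_ok; eauto | subst_eq]. }
  assert (ok2 := subst_ok_up _ _ _ _ _ ok1 HA1).
  assert (W2 := proj1 ok2).
  assert (HA2 : has_type (subst (up f) (shift A) :: subst f A :: D)
                  (subst (up (up f)) (shift (shift A))) (Univ i)).
  { eapply eq_ind with (P := fun X => has_type _ X _);
      [apply HA, shift_ok, shift_ok; eauto | subst_eq]. }
  assert (L0 : forall n B, lookup (shift A :: A :: G) n B ->
            has_type (subst (up f) (shift A) :: subst f A :: D)
              (subst (up (up f)) (Var n)) (subst (up (up f)) B)).
  { intros n B L; apply Q_has_type; [exact W2 | apply ok2, L]. }
  assert (ok3 : subst_ok
            (subst (up (up f)) (Id (shift (shift A)) (Var 1) (Var 0))
               :: subst (up f) (shift A) :: subst f A :: D)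
            (up (up (up f)))
            (Id (shift (shift A)) (Var 1) (Var 0) :: shift A :: A :: G)).
  { eapply subst_ok_up with (i := i); [exact ok2|]; cbn [subst].
    apply t_Id; [exact HA2 | |].
    - apply (L0 1 (shift (shift A))); repeat constructor.
    - apply (L0 0 (shift (shift A))); repeat constructor. }
  revert ok3; unfold id_ctx; cbn [subst]; rewrite !subst_shift; auto.
Qed.

Lemma subst_inst f B a : subst f (inst B a) = inst (subst (up f) B) (subst f a).
Proof. subst_eq. Qed.

Lemma subst_inst2 f B a b :
  subst f (inst2 B a b) = inst2 (subst (up (up f)) B) (subst f a) (subst f b).
Proof. subst_eq. Qed.

Lemma subst_inst3 f B a b c :
  subst f (inst3 B a b c)
  = inst3 (subst (up (up (up f))) B) (subst f a) (subst f b) (subst f c).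
Proof. subst_eq. Qed.

Ltac solve_ok :=
  first
    [ eassumption
    | eapply subst_ok_id_ctx; [eassumption | solve_ok]
    | eapply (subst_ok_up _ _ _ Empty 0); [solve_ok | apply t_Empty; eassumption]
    | eapply (subst_ok_up _ _ _ Unit 0); [solve_ok | apply t_Unit; eassumption]
    | eapply (subst_ok_up _ _ _ Nat 0); [solve_ok | apply t_Nat; eassumption]
    | match goal with |- subst_ok _ _ (?A :: _) =>
        eapply (subst_ok_up _ _ _ A); [solve_ok | cbn [subst]; solve_type]
      end ]
with solve_type :=
  match goal with
  | IH : forall D f, subst_ok D f _ -> has_type D (subst f ?A) (Univ ?i)
    |- has_type _ (subst _ ?A) _ => eapply IH; solve_ok
  | |- has_type _ (Sum _ _) _ => eapply t_Sum; solve_type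
  | |- has_type _ (Sig _ _) _ => eapply t_Sig; solve_type
  end.
Ltac solve_premise :=
  match goal with
  | |- wf _ => assumption
  | |- has_type _ ?t _ =>
      assert_fails (is_evar t);
      match goal with IH : forall D f, subst_ok D f _ -> _ |- _ =>
        eapply has_type_eq; [eapply IH; solve_ok | subst_eq; fail]
      end
  | |- conv _ ?t ?u _ =>
      match goal with IH : forall D f, subst_ok D f _ -> _ |- _ =>
        eapply conv_eq; [eapply IH; solve_ok | subst_eq; fail ..]
      end
  end.

Lemma has_type_subst_gen G t A :
  has_type G t A -> forall D f, subst_ok D f G ->
  has_type D (subst f t) (subst f A).
Proof.
  revert G t A.
  apply (has_type_mut (fun _ => True)
    (fun G t A => forall D f, subst_ok D f G ->
       has_type D (subst f t) (subst f A))
    (fun G t u A => forall D f, subst_ok D f G ->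
       conv D (subst f t) (subst f u) (subst f A))); intros; cbn [subst] in *;
    rewrite ?subst_inst, ?subst_inst2, ?subst_inst3; cbn [subst].
  all: try exact I.
  all: try match goal with H : subst_ok _ _ _ |- _ =>
    assert (W := proj1 H) end.
  all: try solve [econstructor; repeat solve_premise].
  - match goal with H : subst_ok _ _ _ |- _ => apply Q_has_type, H; assumption end.
  (* From here on the rules are eliminations and their computation rules. Their conclusions do not
     determine the domain or the type of the scrutinee, so it is supplied. *)
  - apply t_case with (A := subst f A) (B := subst f B) (i := i) (j := j);
      solve_premise.
  - apply t_app with (A := subst f A) (i := i); solve_premise.
  - apply t_split with (A := subst f A) (B := subst (up f) B) (i := i) (j := j);
      solve_premise.
  - apply t_idrec with (A := subst f A) (i := i) (j := j); solve_premise.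
  - apply c_case with (A := subst f A) (B := subst f B) (i := i) (j := j);
      solve_premise.
  - apply c_case_inl with (A := subst f A) (B := subst f B) (i := i) (j := j);
      solve_premise.
  - apply c_case_inr with (A := subst f A) (B := subst f B) (i := i) (j := j);
      solve_premise.
  - apply c_app with (A := subst f A) (i := i); solve_premise.
  - apply c_beta with (A := subst f A) (i := i); solve_premise.
  - apply c_split with (A := subst f A) (B := subst (up f) B) (i := i) (j := j);
      solve_premise.
  - apply c_split_pair
      with (A := subst f A) (B := subst (up f) B) (i := i) (j := j);
      solve_premise.
  - apply c_idrec with (A := subst f A) (i := i) (j := j); solve_premise.
  - apply c_idrec_refl with (A := subst f A) (i := i) (j := j); solve_premise.
Qed.

End Substitution.

(** * Weakening and substitution for typing derivations *)

Definition well_subst := subst_ok has_type.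

Lemma has_type_shift D B t A :
  wf (B :: D) -> has_type D t A -> has_type (B :: D) (shift t) (shift A).
Proof.
  intros W H; unfold shift; rewrite !ren_subst.
  eapply has_type_subst_gen with
    (Q := fun D t A => exists n, t = Var n /\ lookup D n A); [| | |exact H|].
  - intros D' t' A' W' [n [-> L]]; constructor; assumption.
  - intros D' n A' _ L; exists n; auto.
  - intros D' B' t' A' _ [n [-> L]]; exists (S n); split; [|constructor]; auto.
  - split; [exact W|]; intros n A' L; exists (S n); split; [reflexivity|].
    rewrite <- ren_subst; constructor; exact L.
Qed.

Lemma has_type_subst G t A D f :
  has_type G t A -> well_subst D f G -> has_type D (subst f t) (subst f A).
Proof.
  intros H; apply has_type_subst_gen with (G := G);
    auto using t_var, has_type_shift.
Qed.

Lemma well_subst_cons D f G a A :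
  well_subst D f G -> has_type D a (subst f A) ->
  well_subst D (scons a f) (A :: G).
Proof.
  intros [W H] Ha; split; [exact W|].
  intros n B L; inversion L; subst; cbn;
    (eapply has_type_eq; [eauto | subst_eq]).
Qed.

Lemma well_subst_id G : wf G -> well_subst G Var G.
Proof.
  intros W; split; [exact W|]; intros n A L.
  rewrite subst_id by reflexivity; constructor; assumption.
Qed.

Lemma well_subst_shift D f G B :
  wf (B :: D) -> well_subst D f G -> well_subst (B :: D) (fun n => shift (f n)) G.
Proof.
  intros W [_ H]; split; [exact W|]; intros n A L.
  eapply has_type_eq; [apply has_type_shift; eauto | subst_eq].
Qed.

Lemma well_subst_wk G B :
  wf (B :: G) -> well_subst (B :: G) (fun n => Var (S n)) G.
Proof.
  intros W; apply (well_subst_shift G Var); [exact W|].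
  apply well_subst_id; inversion W; assumption.
Qed.

Lemma has_type_inst G A B t a :
  has_type (A :: G) t B -> has_type G a A -> has_type G (inst t a) (inst B a).
Proof.
  intros Ht Ha; apply (has_type_subst (A :: G)); [exact Ht|].
  apply well_subst_cons; [eapply well_subst_id, has_type_wf, Ha|].
  rewrite subst_id by reflexivity; exact Ha.
Qed.

Lemma inst_shift t a : inst (shift t) a = t.
Proof. subst_eq. Qed.

Lemma shift_arrow A B : shift (arrow A B) = arrow (shift A) (shift B).
Proof. subst_eq. Qed.

Lemma shift_prod A B : shift (prod A B) = prod (shift A) (shift B).
Proof. subst_eq. Qed.

Lemma shift_Sum A B : shift (Sum A B) = Sum (shift A) (shift B).
Proof. reflexivity. Qed.

(** * Inhabitation *)

(** All translated types and formulas lie in [Univ 0]. A larger universe enters only when [Univ 0]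
    itself is the motive, in the large elimination that separates successors from zero. *)
Notation ty G A := (has_type G A (Univ 0)).

Definition inh (G : list term) (A : term) : Prop := exists t, has_type G t A.

Lemma wf_ty_cons G A : ty G A -> wf (A :: G).
Proof. intros H; econstructor; [eapply has_type_wf|]; exact H. Qed.

Lemma ty_shift G A B : ty G B -> ty G A -> ty (B :: G) (shift A).
Proof. intros HB HA; exact (has_type_shift _ _ _ _ (wf_ty_cons _ _ HB) HA). Qed.

Lemma ty_arrow G A B : ty G A -> ty G B -> ty G (arrow A B).
Proof. intros; apply t_Pi; [|apply ty_shift]; assumption. Qed.

Lemma ty_prod G A B : ty G A -> ty G B -> ty G (prod A B).
Proof. intros; apply t_Sig; [|apply ty_shift]; assumption. Qed.

Lemma inh_eq G A B : inh G A -> A = B -> inh G B.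
Proof. intros H <-; exact H. Qed.

Lemma inh_subst G A D f : inh G A -> well_subst D f G -> inh D (subst f A).
Proof. intros [t H] S; exists (subst f t); eapply has_type_subst; eauto. Qed.

Lemma inh_shift G A B : ty G B -> inh G A -> inh (B :: G) (shift A).
Proof.
  intros HB [t H]; exists (shift t); apply has_type_shift; [|exact H].
  apply wf_ty_cons, HB.
Qed.

Lemma inh_var0 G A : ty G A -> inh (A :: G) (shift A).
Proof.
  intros H; exists (Var 0); apply t_var; [apply wf_ty_cons, H | constructor].
Qed.

Lemma inh_pi_intro G A B : ty G A -> ty (A :: G) B -> inh (A :: G) B -> inh G (Pi A B).
Proof. intros HA HB [t H]; exists (lam t); eapply t_lam; eauto. Qed.

Lemma inh_pi_elim G A B a :
  ty G A -> ty (A :: G) B -> inh G (Pi A B) -> has_type G a A -> inh G (inst B a).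
Proof. intros HA HB [t H] Ha; exists (app t a); eapply t_app; eauto. Qed.

Lemma well_subst_up D f G A i :
  well_subst D f G -> has_type D (subst f A) (Univ i) ->
  well_subst (subst f A :: D) (up f) (A :: G).
Proof. apply subst_ok_up; auto using t_var, has_type_shift. Qed.

(** The weakened function is applied to the new variable. This opens a premise below its
    quantifier. *)
Lemma inh_pi_elim_var G A B :
  ty G A -> ty (A :: G) B -> inh G (Pi A B) -> inh (A :: G) B.
Proof.
  intros HA HB H.
  pose (wk := fun n => Var (S n)).
  assert (S1 : well_subst (A :: G) wk G) by (apply well_subst_wk, wf_ty_cons, HA).
  assert (HA' : ty (A :: G) (subst wk A))
    by (apply (has_type_subst G A (Univ 0)); assumption).
  apply inh_eq with (inst (subst (up wk) B) (Var 0)); [|subst_eq].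
  apply inh_pi_elim with (subst wk A).
  - exact HA'.
  - apply (has_type_subst (A :: G) B (Univ 0)); [exact HB|].
    eapply well_subst_up; eassumption.
  - exact (inh_subst _ _ _ _ H S1).
  - unfold wk; rewrite <- ren_subst; apply t_var; [apply S1 | constructor].
Qed.

Lemma inh_arrow_intro G A B :
  ty G A -> ty G B -> inh (A :: G) (shift B) -> inh G (arrow A B).
Proof. intros HA HB; apply inh_pi_intro; [|apply ty_shift]; assumption. Qed.

Lemma inh_arrow_elim G A B :
  ty G A -> ty G B -> inh G (arrow A B) -> inh G A -> inh G B.
Proof.
  intros HA HB H [a Ha]; rewrite <- (inst_shift B a).
  apply inh_pi_elim with A; auto using ty_shift.
Qed.

Lemma inh_arrow_elim_var G A B :
  ty G A -> ty G B -> inh G (arrow A B) -> inh (A :: G) (shift B).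
Proof. intros HA HB; apply inh_pi_elim_var; auto using ty_shift. Qed.

Lemma inh_sig_intro G A B a :
  ty G A -> ty (A :: G) B -> has_type G a A -> inh G (inst B a) ->
  inh G (Sig A B).
Proof. intros HA HB Ha [b Hb]; exists (pair a b); eapply t_pair; eauto. Qed.

(** The motive is constant, which is enough when the goal does not mention the pair. The dependent
    second projection needs [inh_snd]. *)
Lemma inh_sig_elim G A B C :
  ty G A -> ty (A :: G) B -> ty G C ->
  inh G (Sig A B) -> inh (B :: A :: G) (shift (shift C)) -> inh G C.
Proof.
  intros HA HB HC [t Ht] [d Hd]; exists (split d t).
  rewrite <- (inst_shift C t).
  apply t_split with (A := A) (B := B) (i := 0) (j := 0); try assumption.
  - apply ty_shift; [apply t_Sig|]; assumption.
  - eapply has_type_eq; [exact Hd | subst_eq].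
Qed.

Lemma inh_prod_intro G A B :
  ty G A -> ty G B -> inh G A -> inh G B -> inh G (prod A B).
Proof.
  intros HA HB [a Ha] Hb; apply inh_sig_intro with a; auto using ty_shift.
  rewrite inst_shift; exact Hb.
Qed.

Lemma inh_proj1 G A B : ty G A -> ty G B -> inh G (prod A B) -> inh G A.
Proof.
  intros HA HB H; apply inh_sig_elim with A (shift B); auto using ty_shift.
  apply inh_shift; auto using ty_shift, inh_var0.
Qed.

Lemma inh_proj2 G A B : ty G A -> ty G B -> inh G (prod A B) -> inh G B.
Proof.
  intros HA HB H; apply inh_sig_elim with A (shift B); auto using ty_shift.
  apply inh_var0; auto using ty_shift.
Qed.

Lemma inh_inl G A B : ty G A -> ty G B -> inh G A -> inh G (Sum A B).
Proof. intros HA HB [a Ha]; exists (inl a); eapply t_inl; eauto. Qed.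

Lemma inh_inr G A B : ty G A -> ty G B -> inh G B -> inh G (Sum A B).
Proof. intros HA HB [b Hb]; exists (inr b); eapply t_inr; eauto. Qed.

Lemma inh_sum_elim G A B C :
  ty G A -> ty G B -> ty G C -> inh G (Sum A B) ->
  inh (A :: G) (shift C) -> inh (B :: G) (shift C) -> inh G C.
Proof.
  intros HA HB HC [t Ht] [d Hd] [e He]; exists (case d e t).
  rewrite <- (inst_shift C t).
  apply t_case with (A := A) (B := B) (i := 0) (j := 0); try assumption.
  - apply ty_shift; [apply t_Sum|]; assumption.
  - eapply has_type_eq; [exact Hd | subst_eq].
  - eapply has_type_eq; [exact He | subst_eq].
Qed.

Lemma inh_empty_elim G C : ty G C -> inh G Empty -> inh G C.
Proof.
  intros HC [t Ht]; exists (emptyrec t); rewrite <- (inst_shift C t).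
  eapply t_emptyrec; eauto.
  apply ty_shift; [apply t_Empty; eapply has_type_wf|]; eassumption.
Qed.

Lemma inh_natrec G C t :
  ty (Nat :: G) C -> inh G (inst C zero) ->
  inh (C :: Nat :: G) (inst_wk2 C (succ (Var 1))) ->
  has_type G t Nat -> inh G (inst C t).
Proof. intros HC [d Hd] [e He] Ht; exists (natrec d e t); eapply t_natrec; eauto. Qed.

Lemma inh_conv G A B : inh G A -> conv G A B (Univ 0) -> inh G B.
Proof. intros [t H] E; exists t; eapply t_conv; eauto. Qed.

(** [idrec] leaves both endpoints free, so the motive is [C(x) -> C(y)], with the identity function
    in the reflexive case; the result is then applied to the term of [inst C a]. *)
Lemma inh_transport G A C a b :
  ty G A -> ty (A :: G) C -> has_type G a A -> has_type G b A ->
  inh G (Id A a b) -> inh G (inst C a) -> inh G (inst C b).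
Proof.
  intros HA HC Ha Hb [e He] H.
  (* In [id_ctx] the endpoints x and y are the variables 2 and 1. [f i] puts variable [i] for the
     argument of [C] and lets the parameters skip the three new variables. *)
  pose (f i := scons (Var i) (fun n => Var (S (S (S n))))).
  assert (W1 := wf_ty_cons _ _ HA).
  assert (HA1 := ty_shift _ _ _ HA HA).
  assert (W2 := wf_ty_cons _ _ HA1).
  assert (HA2 := ty_shift _ _ _ HA1 HA1).
  assert (W3 : wf (id_ctx G A)).
  { apply wf_ty_cons, t_Id; [exact HA2 | |];
      apply t_var; try exact W2; repeat constructor. }
  assert (S3 : forall i, has_type (id_ctx G A) (Var i) (shift (shift (shift A))) ->
                 well_subst (id_ctx G A) (f i) (A :: G)).
  { intros i Hi; split; [exact W3|]; intros n B L; inversion L; subst; cbn.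
    - eapply has_type_eq; [exact Hi | unfold f; subst_eq].
    - apply t_var; [exact W3|].
      eapply eq_ind with (P := lookup _ _); [do 3 constructor; eassumption|].
      unfold f; subst_eq. }
  assert (HC' : forall i, i < 3 -> i <> 0 -> ty (id_ctx G A) (subst (f i) C)).
  { intros i Li Ni; apply (has_type_subst (A :: G) C (Univ 0)); [exact HC|].
    apply S3, t_var; [exact W3|].
    destruct i as [|[|[|i]]]; [congruence | repeat constructor ..|].
    exfalso; revert Li; clear; intros L; do 3 apply le_S_n in L; inversion L. }
  apply inh_arrow_elim with (inst C a).
  - exact (has_type_inst _ _ _ _ _ HC Ha).
  - exact (has_type_inst _ _ _ _ _ HC Hb).
  - exists (idrec (lam (Var 0)) e).
    apply has_type_eq with (inst3 (arrow (subst (f 2) C) (subst (f 1) C)) a b e);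
      [|unfold f; subst_eq].
    apply t_idrec with (A := A) (i := 0) (j := 0); try assumption.
    + apply ty_arrow; apply HC'; auto.
    + apply has_type_eq with (arrow C C); [|unfold f; subst_eq].
      eapply t_lam; [exact HC | apply ty_shift; exact HC |].
      apply t_var; [apply wf_ty_cons, HC | constructor].
  - exact H.
Qed.

Lemma inh_refl_conv G A a b :
  ty G A -> has_type G a A -> conv G a b A -> inh G (Id A a b).
Proof.
  intros HA Ha E; exists (refl a); eapply t_conv.
  - eapply t_refl; eauto.
  - apply c_Id; [apply c_refl; exact HA | apply c_refl; exact Ha | exact E].
Qed.

(** Replaces the conversion of [inst C a] and [inst C b], which would need congruence for an
    arbitrary family [C]: the reflexivity term is retyped by congruence of [Id] alone and serves for
    transport. *)
Lemma inh_inst_conv G A C a b :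
  ty G A -> ty (A :: G) C -> has_type G a A -> has_type G b A ->
  conv G a b A -> inh G (inst C a) -> inh G (inst C b).
Proof. eauto using inh_transport, inh_refl_conv. Qed.

Lemma inh_subst_conv G A C D f a b :
  ty G A -> ty (A :: G) C -> well_subst D f G ->
  has_type D a (subst f A) -> has_type D b (subst f A) ->
  conv D a b (subst f A) ->
  inh D (subst (scons a f) C) -> inh D (subst (scons b f) C).
Proof.
  intros HA HC S Ha Hb E H.
  assert (HA' : ty D (subst f A))
    by exact (has_type_subst _ _ (Univ 0) _ _ HA S).
  apply inh_eq with (inst (subst (up f) C) b); [|subst_eq].
  apply inh_inst_conv with (subst f A) a; try assumption.
  - apply (has_type_subst (A :: G) C (Univ 0)); [exact HC|].
    eapply well_subst_up; eassumption.
  - eapply inh_eq; [exact H | subst_eq].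
Qed.

(** * Projections from dependent sums and the type-theoretic axiom of choice *)

Lemma has_type_fst G A B t :
  ty G A -> ty (A :: G) B -> has_type G t (Sig A B) ->
  has_type G (split (Var 1) t) A.
Proof.
  intros HA HB Ht; rewrite <- (inst_shift A t) at 1.
  apply t_split with (A := A) (B := B) (i := 0) (j := 0); try assumption.
  - apply ty_shift; [apply t_Sig|]; assumption.
  - apply has_type_eq with (shift (shift A)); [|subst_eq].
    apply t_var; [apply wf_ty_cons, HB | repeat constructor].
Qed.

Lemma conv_fst_pair G A B a b :
  ty G A -> ty (A :: G) B -> has_type G a A -> has_type G b (inst B a) ->
  conv G (split (Var 1) (pair a b)) a A.
Proof.
  intros HA HB Ha Hb.
  apply conv_eq with (split (Var 1) (pair a b)) (inst2 (Var 1) a b)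
    (inst (shift A) (pair a b)); [|subst_eq ..].
  apply c_split_pair with (A := A) (B := B) (i := 0) (j := 0); try assumption.
  - apply ty_shift; [apply t_Sig|]; assumption.
  - apply has_type_eq with (shift (shift A)); [|subst_eq].
    apply t_var; [apply wf_ty_cons, HB | repeat constructor].
Qed.

(** The motive is [B] at the first projection of the pair. In the branch the last variable has type
    [B] at the first component, whereas [B] at the projection of the pair is wanted; the two
    arguments agree by the computation rule of [split], and [inh_subst_conv] bridges the gap. *)
Lemma inh_snd G A B t :
  ty G A -> ty (A :: G) B -> has_type G t (Sig A B) ->
  inh G (inst B (split (Var 1) t)).
Proof.
  intros HA HB Ht.
  assert (HS : ty G (Sig A B)) by (apply t_Sig; assumption).
  assert (W := wf_ty_cons _ _ HB).
  assert (WS := wf_ty_cons _ _ HS).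
  assert (SW : well_subst (B :: A :: G) (fun n => Var (S (S n))) G).
  { apply (well_subst_shift _ (fun n => Var (S n))); [exact W|].
    apply well_subst_wk, wf_ty_cons, HA. }
  assert (HA2 : ty (B :: A :: G) (shift (shift A)))
    by (apply ty_shift, ty_shift; assumption).
  assert (V1 : has_type (B :: A :: G) (Var 1) (shift (shift A)))
    by (apply t_var; [exact W | repeat constructor]).
  assert (V0 : has_type (B :: A :: G) (Var 0) (shift B))
    by (apply t_var; [exact W | constructor]).
  assert (HB2 : ty (shift (shift A) :: B :: A :: G)
                  (subst (up (fun n => Var (S (S n)))) B)).
  { replace (shift (shift A)) with (subst (fun n => Var (S (S n))) A) by subst_eq.
    apply (has_type_subst (A :: G) B (Univ 0)); [exact HB|].
    apply well_subst_up with 0; [exact SW|].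
    exact (has_type_subst _ _ _ _ _ HA SW). }
  assert (V0' : has_type (B :: A :: G) (Var 0)
                  (inst (subst (up (fun n => Var (S (S n)))) B) (Var 1)))
    by (eapply has_type_eq; [exact V0 | subst_eq]).
  pose (C := subst (scons (split (Var 1) (Var 0)) (fun n => Var (S n))) B).
  assert (Hd : inh (B :: A :: G) (inst_wk2 C (pair (Var 1) (Var 0)))).
  { apply inh_eq with (subst (scons (split (Var 1) (pair (Var 1) (Var 0)))
                                (fun n => Var (S (S n)))) B);
      [|unfold C; subst_eq].
    apply inh_subst_conv with G A (Var 1); try assumption.
    - eapply has_type_eq; [exact V1 | subst_eq].
    - apply has_type_eq with (shift (shift A)); [|subst_eq].
      eapply has_type_fst; [exact HA2 | exact HB2 |].
      eapply t_pair; [exact HA2 | exact HB2 | exact V1 | exact V0'].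
    - replace (subst (fun n => Var (S (S n))) A) with (shift (shift A)) by subst_eq.
      eapply c_sym, conv_fst_pair; [exact HA2 | exact HB2 | exact V1 | exact V0'].
    - eapply inh_eq; [exists (Var 0); exact V0 | subst_eq]. }
  destruct Hd as [d Hd].
  exists (split d t).
  apply has_type_eq with (inst C t); [|unfold C; subst_eq].
  apply t_split with (A := A) (B := B) (i := 0) (j := 0); try assumption.
  apply (has_type_subst (A :: G) B (Univ 0)); [exact HB|].
  apply well_subst_cons; [apply well_subst_wk, WS|].
  replace (subst (fun n => Var (S n)) A) with (shift A) by subst_eq.
  pose (SW1 := well_subst_wk _ _ WS).
  assert (HA1 : ty (Sig A B :: G) (subst (fun n => Var (S n)) A))
    by exact (has_type_subst _ _ _ _ _ HA SW1).
  apply has_type_eq with (subst (fun n => Var (S n)) A); [|subst_eq].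
  apply has_type_fst with (subst (up (fun n => Var (S n))) B).
  - exact HA1.
  - apply (has_type_subst (A :: G) B (Univ 0)); [exact HB|].
    apply well_subst_up with 0; assumption.
  - apply t_var; [exact WS|].
    replace (Sig (subst (fun n => Var (S n)) A) (subst (up (fun n => Var (S n))) B))
      with (shift (Sig A B)) by subst_eq.
    constructor.
Qed.

(* [lam (split (Var 1) z)] applied to a variable is equal to the first projection
   only up to beta, so its second component is moved along this equality. *)
Lemma inh_choice G A B P :
  ty G A -> ty (A :: G) B -> ty (B :: A :: G) P ->
  inh G (Pi A (Sig B P)) ->
  inh G (Sig (Pi A B)
          (Pi (shift A)
             (subst (scons (app (Var 1) (Var 0))
                      (scons (Var 0) (fun n => Var (S (S n))))) P))).
Proof.
  intros HA HB HP H.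
  apply inh_pi_elim_var in H; [|assumption|apply t_Sig; assumption].
  destruct H as [z Hz].
  pose (b := split (Var 1) z).
  assert (Hb : has_type (A :: G) b B) by (apply has_type_fst with P; assumption).
  assert (HAB : ty G (Pi A B)) by (apply t_Pi; assumption).
  assert (HF : has_type G (lam b) (Pi A B)) by (eapply t_lam; eassumption).
  assert (HA' : ty (A :: G) (shift A)) by (apply ty_shift; assumption).
  assert (W := wf_ty_cons _ _ HA).
  assert (V0 : has_type (A :: G) (Var 0) (shift A))
    by (apply t_var; [exact W | constructor]).
  assert (SW := well_subst_wk _ _ W).
  pose (wk := fun n => Var (S n)).
  assert (HB1 : ty (subst wk A :: A :: G) (subst (up wk) B)).
  { apply (has_type_subst (A :: G) B (Univ 0)); [exact HB|].
    apply well_subst_up with 0; [exact SW|].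
    exact (has_type_subst _ _ _ _ _ HA SW). }
  apply inh_sig_intro with (lam b); [exact HAB | | exact HF |].
  - assert (W1 := wf_ty_cons _ _ HAB).
    assert (HA1 : ty (Pi A B :: G) (shift A)) by (apply ty_shift; assumption).
    apply t_Pi; [exact HA1|].
    assert (W2 := wf_ty_cons _ _ HA1).
    assert (V0' : has_type (shift A :: Pi A B :: G) (Var 0)
                    (subst (fun n => Var (S (S n))) A)).
    { apply has_type_eq with (shift (shift A)); [|subst_eq].
      apply t_var; [exact W2 | constructor]. }
    assert (SW2 : well_subst (shift A :: Pi A B :: G) (fun n => Var (S (S n))) G).
    { apply (well_subst_shift _ (fun n => Var (S n))); [exact W2|].
      apply well_subst_wk, W1. }
    assert (HA2 : ty (shift A :: Pi A B :: G) (subst (fun n => Var (S (S n))) A))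
      by exact (has_type_subst _ _ (Univ 0) _ _ HA SW2).
    apply (has_type_subst (B :: A :: G) P (Univ 0)); [exact HP|].
    apply well_subst_cons; [apply well_subst_cons; [exact SW2 | exact V0']|].
    apply has_type_eq with
      (inst (subst (up (fun n => Var (S (S n)))) B) (Var 0)); [|subst_eq].
    eapply t_app; [exact HA2 | | | exact V0'].
    + apply (has_type_subst (A :: G) B (Univ 0)); [exact HB|].
      apply well_subst_up with 0; assumption.
    + apply has_type_eq with (shift (shift (Pi A B))); [|subst_eq].
      apply t_var; [exact W2 | repeat constructor].
  - apply inh_eq with
      (Pi A (subst (scons (app (shift (lam b)) (Var 0)) Var) P)); [|subst_eq].
    assert (E : conv (A :: G) (app (shift (lam b)) (Var 0)) b B).
    { apply conv_eq with
        (app (lam (subst (up wk) b)) (Var 0)) (inst (subst (up wk) b) (Var 0))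
        (inst (subst (up wk) B) (Var 0)); [|subst_eq ..].
      apply c_beta with (A := subst wk A) (i := 0).
      - apply has_type_eq with (subst wk (Univ 0)); [|reflexivity].
        apply (has_type_subst G); assumption.
      - exact HB1.
      - apply (has_type_subst (A :: G)); [exact Hb|].
        apply well_subst_up with 0; [exact SW|].
        exact (has_type_subst _ _ _ _ _ HA SW).
      - eapply has_type_eq; [exact V0 | subst_eq]. }
    assert (Happ : has_type (A :: G) (app (shift (lam b)) (Var 0)) B).
    { apply has_type_eq with (inst (subst (up wk) B) (Var 0)); [|subst_eq].
      apply t_app with (A := subst wk A) (B := subst (up wk) B) (i := 0).
      - exact (has_type_subst _ _ _ _ _ HA SW).
      - exact HB1.
      - apply has_type_eq with (shift (Pi A B)); [|subst_eq].
        apply has_type_shift; assumption.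
      - eapply has_type_eq; [exact V0 | subst_eq]. }
    apply inh_pi_intro; [exact HA | | ].
    + exact (has_type_inst _ _ _ _ _ HP Happ).
    + apply (inh_inst_conv (A :: G) B P b); try assumption.
      * exact (c_sym E).
      * apply inh_snd with B; assumption.
Qed.

(** * Translated types and constants *)

Lemma subst_tr_ty f s : subst f (tr_ty s) = tr_ty s.
Proof.
  revert f; induction s; intros f; cbn; unfold arrow, prod, shift;
    rewrite ?ren_subst; cbn; congruence.
Qed.

Lemma shift_tr_ty s : shift (tr_ty s) = tr_ty s.
Proof. unfold shift; rewrite ren_subst; apply subst_tr_ty. Qed.

Lemma ty_tr_ty G s : wf G -> ty G (tr_ty s).
Proof.
  intros W; induction s; cbn; auto using t_Nat, ty_arrow, ty_prod.
Qed.

Lemma wf_cons_tr G s : wf G -> wf (tr_ty s :: G).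
Proof. intros W; apply wf_ty_cons, ty_tr_ty, W. Qed.

(** Translated types are closed, so the shift hidden in [arrow] disappears and the rules for [Pi]
    apply to the codomain as it is. *)
Lemma tr_ty_arr s t : tr_ty (HAomega.Arr s t) = Pi (tr_ty s) (tr_ty t).
Proof. cbn; unfold arrow; rewrite shift_tr_ty; reflexivity. Qed.

Lemma tr_ty_prd s t : tr_ty (HAomega.Prd s t) = Sig (tr_ty s) (tr_ty t).
Proof. cbn; unfold prod; rewrite shift_tr_ty; reflexivity. Qed.

(** * Derived typing and conversion rules at translated types *)

Section SimpleTypes.

Variable G : list term.

Lemma st_var0 s : wf G -> has_type (tr_ty s :: G) (Var 0) (tr_ty s).
Proof.
  intros W; rewrite <- (shift_tr_ty s) at 2.
  apply t_var; [apply wf_cons_tr, W | constructor].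
Qed.

Lemma st_shift t s B :
  wf (B :: G) -> has_type G t (tr_ty s) -> has_type (B :: G) (shift t) (tr_ty s).
Proof.
  intros W H; rewrite <- (shift_tr_ty s); apply has_type_shift; assumption.
Qed.

Lemma st_lam s t b :
  has_type (tr_ty s :: G) b (tr_ty t) ->
  has_type G (lam b) (tr_ty (HAomega.Arr s t)).
Proof.
  intros H; rewrite tr_ty_arr.
  assert (W := has_type_wf _ _ _ H).
  eapply t_lam with (i := 0); [| |exact H]; apply ty_tr_ty; [|exact W].
  inversion W; assumption.
Qed.

Lemma st_app s t f a :
  has_type G f (tr_ty (HAomega.Arr s t)) -> has_type G a (tr_ty s) ->
  has_type G (app f a) (tr_ty t).
Proof.
  intros Hf Ha; assert (W := has_type_wf _ _ _ Ha).
  rewrite tr_ty_arr in Hf.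
  apply has_type_eq with (inst (tr_ty t) a); [|apply subst_tr_ty].
  eapply t_app with (i := 0); [| |exact Hf|exact Ha]; apply ty_tr_ty;
    auto using wf_cons_tr.
Qed.

Lemma st_app_conv s t f f' a a' :
  conv G f f' (tr_ty (HAomega.Arr s t)) -> conv G a a' (tr_ty s) -> wf G ->
  conv G (app f a) (app f' a') (tr_ty t).
Proof.
  intros Hf Ha W; rewrite tr_ty_arr in Hf.
  apply conv_eq with (app f a) (app f' a') (inst (tr_ty t) a);
    [|try reflexivity; apply subst_tr_ty ..].
  eapply c_app with (i := 0); [| |exact Hf|exact Ha]; apply ty_tr_ty;
    auto using wf_cons_tr.
Qed.

Lemma st_beta s t b a c :
  has_type (tr_ty s :: G) b (tr_ty t) -> has_type G a (tr_ty s) ->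
  inst b a = c -> conv G (app (lam b) a) c (tr_ty t).
Proof.
  intros Hb Ha <-; assert (W := has_type_wf _ _ _ Ha).
  apply conv_eq with (app (lam b) a) (inst b a) (inst (tr_ty t) a);
    [|try reflexivity; apply subst_tr_ty ..].
  eapply c_beta with (i := 0); [| |exact Hb|exact Ha]; apply ty_tr_ty;
    auto using wf_cons_tr.
Qed.

Lemma st_pair s t a b :
  has_type G a (tr_ty s) -> has_type G b (tr_ty t) ->
  has_type G (pair a b) (tr_ty (HAomega.Prd s t)).
Proof.
  intros Ha Hb; assert (W := has_type_wf _ _ _ Ha); rewrite tr_ty_prd.
  eapply t_pair with (i := 0); [| |exact Ha|]; auto using ty_tr_ty, wf_cons_tr.
  unfold inst; rewrite subst_tr_ty; exact Hb.
Qed.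

Lemma st_split s t r d p :
  has_type (tr_ty t :: tr_ty s :: G) d (tr_ty r) ->
  has_type G p (tr_ty (HAomega.Prd s t)) ->
  has_type G (split d p) (tr_ty r).
Proof.
  intros Hd Hp; assert (W := has_type_wf _ _ _ Hp).
  assert (WP := wf_cons_tr _ (HAomega.Prd s t) W).
  rewrite tr_ty_prd in *.
  apply has_type_eq with (inst (tr_ty r) p); [|apply subst_tr_ty].
  apply t_split with (A := tr_ty s) (B := tr_ty t) (i := 0) (j := 0);
    auto using ty_tr_ty, wf_cons_tr.
  unfold inst_wk2; rewrite subst_tr_ty; exact Hd.
Qed.

Lemma st_split_pair s t r d a b c :
  has_type (tr_ty t :: tr_ty s :: G) d (tr_ty r) ->
  has_type G a (tr_ty s) -> has_type G b (tr_ty t) ->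
  inst2 d a b = c -> conv G (split d (pair a b)) c (tr_ty r).
Proof.
  intros Hd Ha Hb <-; assert (W := has_type_wf _ _ _ Ha).
  assert (WP := wf_cons_tr _ (HAomega.Prd s t) W).
  rewrite tr_ty_prd in *.
  apply conv_eq with (split d (pair a b)) (inst2 d a b) (inst (tr_ty r) (pair a b));
    [|try reflexivity; apply subst_tr_ty ..].
  apply c_split_pair with (A := tr_ty s) (B := tr_ty t) (i := 0) (j := 0);
    auto using ty_tr_ty, wf_cons_tr;
    unfold inst, inst_wk2; rewrite subst_tr_ty; assumption.
Qed.

Lemma st_natrec s d e n :
  has_type G d (tr_ty s) -> has_type (tr_ty s :: Nat :: G) e (tr_ty s) ->
  has_type G n Nat -> has_type G (natrec d e n) (tr_ty s).
Proof.
  intros Hd He Hn; assert (W := has_type_wf _ _ _ Hd).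
  apply has_type_eq with (inst (tr_ty s) n); [|apply subst_tr_ty].
  eapply t_natrec with (j := 0); [| | |exact Hn].
  - apply ty_tr_ty, (wf_cons_tr _ HAomega.N W).
  - unfold inst; rewrite subst_tr_ty; exact Hd.
  - unfold inst_wk2; rewrite subst_tr_ty; exact He.
Qed.

Lemma st_natrec_zero s d e :
  has_type G d (tr_ty s) -> has_type (tr_ty s :: Nat :: G) e (tr_ty s) ->
  conv G (natrec d e zero) d (tr_ty s).
Proof.
  intros Hd He; assert (W := has_type_wf _ _ _ Hd).
  apply conv_eq with (natrec d e zero) d (inst (tr_ty s) zero);
    [|try reflexivity; apply subst_tr_ty ..].
  eapply c_natrec_zero with (j := 0).
  - apply ty_tr_ty, (wf_cons_tr _ HAomega.N W).
  - unfold inst; rewrite subst_tr_ty; exact Hd.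
  - unfold inst_wk2; rewrite subst_tr_ty; exact He.
Qed.

Lemma st_natrec_succ s d e n c :
  has_type G d (tr_ty s) -> has_type (tr_ty s :: Nat :: G) e (tr_ty s) ->
  has_type G n Nat -> inst2 e n (natrec d e n) = c ->
  conv G (natrec d e (succ n)) c (tr_ty s).
Proof.
  intros Hd He Hn <-; assert (W := has_type_wf _ _ _ Hd).
  apply conv_eq with (natrec d e (succ n)) (inst2 e n (natrec d e n))
    (inst (tr_ty s) (succ n)); [|try reflexivity; apply subst_tr_ty ..].
  eapply c_natrec_succ with (j := 0); [| | |exact Hn].
  - apply ty_tr_ty, (wf_cons_tr _ HAomega.N W).
  - unfold inst; rewrite subst_tr_ty; exact Hd.
  - unfold inst_wk2; rewrite subst_tr_ty; exact He.
Qed.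

Lemma st_natrec_conv s d e n n' :
  has_type G d (tr_ty s) -> has_type (tr_ty s :: Nat :: G) e (tr_ty s) ->
  conv G n n' Nat -> conv G (natrec d e n) (natrec d e n') (tr_ty s).
Proof.
  intros Hd He Hn; assert (W := has_type_wf _ _ _ Hd).
  apply conv_eq with (natrec d e n) (natrec d e n') (inst (tr_ty s) n);
    [|try reflexivity; apply subst_tr_ty ..].
  eapply c_natrec with (j := 0); [| | |exact Hn].
  - apply ty_tr_ty, (wf_cons_tr _ HAomega.N W).
  - unfold inst; rewrite subst_tr_ty; apply c_refl; exact Hd.
  - unfold inst_wk2; rewrite subst_tr_ty; apply c_refl; exact He.
Qed.

End SimpleTypes.

(** Closed types absorb the shifts of [lookup], so that typing a variable becomes a computation with
    [nth_error]. *)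
Lemma st_var G n s :
  wf G -> nth_error G n = Some (tr_ty s) -> has_type G (Var n) (tr_ty s).
Proof.
  revert n; induction G as [|B G IH]; intros [|n] W E; try discriminate; cbn in E.
  - injection E as ->; apply st_var0; inversion W; assumption.
  - apply (st_shift G (Var n)); [exact W|].
    apply IH; [inversion W; assumption | exact E].
Qed.

Ltac solve_wf := first [assumption | apply wf_cons_tr; solve_wf
                       | apply (wf_cons_tr _ HAomega.N); solve_wf].

Lemma tr_const_type G s (c : HAomega.const s) :
  wf G -> has_type G (tr_const c) (tr_ty s).
Proof.
  intros W; destruct c; cbn [tr_const].
  - apply t_zero, W.
  - apply (st_lam G HAomega.N HAomega.N), t_succ, (st_var _ _ HAomega.N);
      [solve_wf | reflexivity].
  - do 3 apply st_lam; apply st_natrec.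
    + apply st_var; [solve_wf | reflexivity].
    + eapply st_app; [eapply st_app|]; apply st_var; try solve_wf; reflexivity.
    + apply (st_var _ _ HAomega.N); [solve_wf | reflexivity].
  - do 2 apply st_lam; apply st_pair; apply st_var; try solve_wf; reflexivity.
  - apply st_lam; eapply st_split; apply st_var; try solve_wf; reflexivity.
  - apply st_lam; eapply st_split; apply st_var; try solve_wf; reflexivity.
  - do 2 apply st_lam; apply st_var; try solve_wf; reflexivity.
  - do 3 apply st_lam; eapply st_app; eapply st_app; apply st_var;
      try solve_wf; reflexivity.
Qed.

Lemma well_subst_scons_tr G s a :
  has_type G a (tr_ty s) -> well_subst G (scons a Var) (tr_ty s :: G).
Proof.
  intros Ha; apply well_subst_cons; [apply well_subst_id; eapply has_type_wf, Ha|].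
  rewrite subst_tr_ty; exact Ha.
Qed.

Lemma well_subst_up_tr D f G s :
  well_subst D f G -> well_subst (tr_ty s :: D) (up f) (tr_ty s :: G).
Proof.
  intros S; rewrite <- (subst_tr_ty f s) at 1.
  apply well_subst_up with 0; [exact S|].
  rewrite subst_tr_ty; apply ty_tr_ty, S.
Qed.

Lemma st_subst G D f t s :
  has_type G t (tr_ty s) -> well_subst D f G -> has_type D (subst f t) (tr_ty s).
Proof.
  intros H S; rewrite <- (subst_tr_ty f s); eapply has_type_subst; eassumption.
Qed.

Lemma st_beta2 G s t r b x y z :
  has_type (tr_ty t :: tr_ty s :: G) b (tr_ty r) ->
  has_type G x (tr_ty s) -> has_type G y (tr_ty t) -> inst2 b x y = z ->
  conv G (app (app (lam (lam b)) x) y) z (tr_ty r).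
Proof.
  intros Hb Hx Hy <-; assert (W := has_type_wf _ _ _ Hx).
  eapply c_trans.
  - eapply st_app_conv with (s := t); [|apply c_refl, Hy | exact W].
    eapply st_beta; [apply st_lam, Hb | exact Hx | reflexivity].
  - cbn; eapply st_beta; [|exact Hy | subst_eq].
    eapply st_subst; [exact Hb|].
    apply well_subst_up_tr, well_subst_scons_tr, Hx.
Qed.

Lemma st_beta3 G s t u r b x y w z :
  has_type (tr_ty u :: tr_ty t :: tr_ty s :: G) b (tr_ty r) ->
  has_type G x (tr_ty s) -> has_type G y (tr_ty t) -> has_type G w (tr_ty u) ->
  inst3 b x y w = z ->
  conv G (app (app (app (lam (lam (lam b))) x) y) w) z (tr_ty r).
Proof.
  intros Hb Hx Hy Hw <-; assert (W := has_type_wf _ _ _ Hx).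
  eapply c_trans.
  - eapply st_app_conv with (s := u); [|apply c_refl, Hw | exact W].
    eapply st_beta2; [apply st_lam, Hb | exact Hx | exact Hy | reflexivity].
  - cbn; eapply st_beta; [|exact Hw | subst_eq].
    eapply st_subst; [exact Hb|].
    apply well_subst_up_tr, well_subst_cons; [apply well_subst_scons_tr, Hx|].
    rewrite subst_tr_ty; exact Hy.
Qed.

(** * Defining equations of the constants as conversions *)

Section Constants.

Variable G : list term.
Hypothesis W : wf G.

Ltac st_vars := repeat first
  [ apply st_var; [solve_wf | reflexivity]
  | apply (st_var _ _ HAomega.N); [solve_wf | reflexivity]
  | eapply st_app ].

Lemma tr_K_conv s t a b :
  has_type G a (tr_ty s) -> has_type G b (tr_ty t) ->
  conv G (app (app (tr_const (HAomega.cK s t)) a) b) a (tr_ty s).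
Proof.
  intros Ha Hb; eapply st_beta2; [|exact Ha|exact Hb|reflexivity]; st_vars.
Qed.

Lemma tr_S_conv r s t a b c :
  has_type G a (tr_ty (HAomega.Arr r (HAomega.Arr s t))) ->
  has_type G b (tr_ty (HAomega.Arr r s)) -> has_type G c (tr_ty r) ->
  conv G (app (app (app (tr_const (HAomega.cS r s t)) a) b) c)
    (app (app a c) (app b c)) (tr_ty t).
Proof.
  intros Ha Hb Hc.
  eapply st_beta3; [|exact Ha|exact Hb|exact Hc|reflexivity]; st_vars.
Qed.

Lemma tr_pair_conv s t a b :
  has_type G a (tr_ty s) -> has_type G b (tr_ty t) ->
  conv G (app (app (tr_const (HAomega.cPair s t)) a) b) (pair a b)
    (tr_ty (HAomega.Prd s t)).
Proof.
  intros Ha Hb; eapply st_beta2; [|exact Ha|exact Hb|reflexivity].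
  apply st_pair; st_vars.
Qed.

(** Kept separate from [tr_fst_conv] because surjective pairing is checked on a raw [pair], in the
    branch of a [split]. *)
Lemma tr_fst_pair_conv s t a b :
  has_type G a (tr_ty s) -> has_type G b (tr_ty t) ->
  conv G (app (tr_const (HAomega.cFst s t)) (pair a b)) a (tr_ty s).
Proof.
  intros Ha Hb.
  assert (Hp := st_pair _ _ _ _ _ Ha Hb).
  eapply c_trans.
  - eapply st_beta; [|exact Hp|reflexivity].
    eapply (st_split _ s t); st_vars.
  - eapply st_split_pair; [|exact Ha|exact Hb|reflexivity]; st_vars.
Qed.

Lemma tr_snd_pair_conv s t a b :
  has_type G a (tr_ty s) -> has_type G b (tr_ty t) ->
  conv G (app (tr_const (HAomega.cSnd s t)) (pair a b)) b (tr_ty t).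
Proof.
  intros Ha Hb.
  assert (Hp := st_pair _ _ _ _ _ Ha Hb).
  eapply c_trans.
  - eapply st_beta; [|exact Hp|reflexivity].
    eapply (st_split _ s t); st_vars.
  - eapply st_split_pair; [|exact Ha|exact Hb|reflexivity]; st_vars.
Qed.

Lemma tr_fst_conv s t a b :
  has_type G a (tr_ty s) -> has_type G b (tr_ty t) ->
  conv G (app (tr_const (HAomega.cFst s t))
            (app (app (tr_const (HAomega.cPair s t)) a) b)) a (tr_ty s).
Proof.
  intros Ha Hb; eapply c_trans; [|apply (tr_fst_pair_conv s t a b); assumption].
  eapply st_app_conv; [apply c_refl, tr_const_type, W | | exact W].
  apply tr_pair_conv; assumption.
Qed.

Lemma tr_snd_conv s t a b :
  has_type G a (tr_ty s) -> has_type G b (tr_ty t) ->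
  conv G (app (tr_const (HAomega.cSnd s t))
            (app (app (tr_const (HAomega.cPair s t)) a) b)) b (tr_ty t).
Proof.
  intros Ha Hb; eapply c_trans; [|apply (tr_snd_pair_conv s t a b); assumption].
  eapply st_app_conv; [apply c_refl, tr_const_type, W | | exact W].
  apply tr_pair_conv; assumption.
Qed.

Lemma tr_succ_conv n :
  has_type G n Nat -> conv G (app (tr_const HAomega.cSucc) n) (succ n) Nat.
Proof.
  intros Hn.
  apply (st_beta G HAomega.N HAomega.N); [apply t_succ; st_vars|exact Hn|reflexivity].
Qed.

(** The common form through which both recursor equations pass. In the step, variable 0 is the
    recursive value and variable 1 the number, and [b] is weakened past both. *)
Lemma tr_rec_conv s a b n :
  has_type G a (tr_ty s) ->
  has_type G b (tr_ty (HAomega.Arr s (HAomega.Arr HAomega.N s))) ->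
  has_type G n Nat ->
  conv G (app (app (app (tr_const (HAomega.cRec s)) a) b) n)
    (natrec a (app (app (shift (shift b)) (Var 0)) (Var 1)) n) (tr_ty s).
Proof.
  intros Ha Hb Hn.
  eapply (st_beta3 _ _ _ HAomega.N); [|exact Ha|exact Hb|exact Hn|reflexivity].
  apply st_natrec; st_vars.
Qed.

Lemma rec_step_type s b :
  has_type G b (tr_ty (HAomega.Arr s (HAomega.Arr HAomega.N s))) ->
  has_type (tr_ty s :: Nat :: G)
    (app (app (shift (shift b)) (Var 0)) (Var 1)) (tr_ty s).
Proof.
  intros Hb; eapply st_app; [eapply st_app|];
    [do 2 (apply st_shift; [solve_wf|]); exact Hb | st_vars ..].
Qed.

Lemma tr_rec_zero_conv s a b :
  has_type G a (tr_ty s) ->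
  has_type G b (tr_ty (HAomega.Arr s (HAomega.Arr HAomega.N s))) ->
  conv G (app (app (app (tr_const (HAomega.cRec s)) a) b) zero) a (tr_ty s).
Proof.
  intros Ha Hb; eapply c_trans; [apply tr_rec_conv; auto using t_zero|].
  apply st_natrec_zero; auto using rec_step_type.
Qed.

Lemma tr_rec_succ_conv s a b n :
  has_type G a (tr_ty s) ->
  has_type G b (tr_ty (HAomega.Arr s (HAomega.Arr HAomega.N s))) ->
  has_type G n Nat ->
  conv G
    (app (app (app (tr_const (HAomega.cRec s)) a) b) (app (tr_const HAomega.cSucc) n))
    (app (app b (app (app (app (tr_const (HAomega.cRec s)) a) b) n)) n) (tr_ty s).
Proof.
  intros Ha Hb Hn.
  assert (He := rec_step_type _ _ Hb).
  assert (HS : has_type G (app (tr_const HAomega.cSucc) n) Nat).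
  { eapply (st_app _ HAomega.N HAomega.N); [apply tr_const_type, W | exact Hn]. }
  eapply c_trans; [apply tr_rec_conv; assumption|].
  (* The scrutinee is the translated successor applied to [n]; [natrec] computes only once it has
     been reduced to the raw [succ n]. *)
  eapply c_trans; [apply st_natrec_conv; [exact Ha|exact He|apply tr_succ_conv, Hn]|].
  eapply c_trans.
  { apply st_natrec_succ
      with (c := app (app b (natrec a
        (app (app (shift (shift b)) (Var 0)) (Var 1)) n)) n);
      [exact Ha | exact He | exact Hn | subst_eq]. }
  eapply st_app_conv; [|apply (c_refl (A := tr_ty HAomega.N)), Hn | exact W].
  eapply st_app_conv; [apply c_refl, Hb| |exact W].
  (* The recursive call is folded back from [natrec] to the recursor. *)
  apply c_sym, tr_rec_conv; assumption.
Qed.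

End Constants.

(** * Translated formulas *)

Lemma wf_tr_ctx G : wf (tr_ctx G).
Proof. induction G; cbn; [constructor | apply wf_cons_tr; assumption]. Qed.

Lemma tr_tm_type G s (a : HAomega.tm G s) :
  has_type (tr_ctx G) (tr_tm a) (tr_ty s).
Proof.
  induction a as [s x | s c | s t a IHa b IHb]; cbn [tr_tm].
  - apply st_var; [apply wf_tr_ctx|].
    induction x; [reflexivity | assumption].
  - apply tr_const_type, wf_tr_ctx.
  - eapply st_app; eassumption.
Qed.

Lemma tr_form_type G (p : HAomega.form G) : ty (tr_ctx G) (tr_form p).
Proof.
  assert (W := wf_tr_ctx).
  induction p; cbn [tr_form];
    eauto using t_Empty, t_Id, ty_tr_ty, tr_tm_type, ty_prod, ty_arrow, t_Sum.
  - apply t_Pi; auto using ty_tr_ty.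
  - apply t_Sig; auto using ty_tr_ty.
Qed.

(** A relation, since [f] is defined on the variables of [G] only and [g] on all indices: agreement
    is asked on the translated variables. *)
Definition tr_subst {G D} (f : HAomega.subst G D) (g : nat -> term) : Prop :=
  forall s (x : HAomega.var G s), g (tr_var x) = tr_tm (f s x).

(** Case analysis on a variable in a nonempty context. The return clause computes on the context
    index, so no equation between contexts has to be transported along. *)
Lemma var_cons_ind G s (P : forall t, HAomega.var (s :: G) t -> Prop) :
  P s HAomega.vz -> (forall t y, P t (HAomega.vs y)) -> forall t x, P t x.
Proof.
  intros Hz Hs t x; revert P Hz Hs.
  refine (match x as x0 in HAomega.var L t0
          return (match L return HAomega.var L t0 -> Prop with
                  | nil => fun _ => True
                  | s' :: G' => fun x =>
                      forall P : forall t, HAomega.var (s' :: G') t -> Prop,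
                      P s' HAomega.vz -> (forall t y, P t (HAomega.vs y)) ->
                      P t0 x
                  end) x0
          with
          | HAomega.vz => fun P Hz _ => Hz
          | HAomega.vs y => fun P _ Hs => Hs _ y
          end).
Qed.

Lemma tr_subst_scons G D s (a : HAomega.tm D s) (f : HAomega.subst G D) g :
  tr_subst f g -> tr_subst (HAomega.scons a f) (scons (tr_tm a) g).
Proof. intros H t x; revert t x; apply var_cons_ind; [reflexivity | exact H]. Qed.

Lemma tr_const_closed s (c : HAomega.const s) f : subst f (tr_const c) = tr_const c.
Proof. destruct c; reflexivity. Qed.

Lemma tr_tm_subst G D (f : HAomega.subst G D) g s (a : HAomega.tm G s) :
  tr_subst f g -> tr_tm (HAomega.subst_tm f a) = subst g (tr_tm a).
Proof.
  intros H; induction a; cbn.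
  - symmetry; apply H.
  - symmetry; apply tr_const_closed.
  - congruence.
Qed.

Lemma tr_subst_shift G s : tr_subst (@HAomega.shift G s) (fun n => Var (S n)).
Proof. intros t x; reflexivity. Qed.

Lemma tr_subst_up G D s (f : HAomega.subst G D) g :
  tr_subst f g -> tr_subst (@HAomega.up G D s f) (up g).
Proof.
  intros H; apply (tr_subst_scons _ _ _ (HAomega.Var HAomega.vz)).
  intros t x; rewrite H, (tr_tm_subst _ _ _ _ _ _ (tr_subst_shift _ _)).
  symmetry; rewrite <- ren_subst; reflexivity.
Qed.

Lemma subst_arrow f A B : subst f (arrow A B) = arrow (subst f A) (subst f B).
Proof. subst_eq. Qed.

Lemma subst_prod f A B : subst f (prod A B) = prod (subst f A) (subst f B).
Proof. subst_eq. Qed.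

(** Makes the translations of [inst], [weak], [inst_succ] and the matrix of [AllApp] into
    substitutions on the side of MLTT, as its rules require. *)
Lemma tr_form_subst G D (f : HAomega.subst G D) g (p : HAomega.form G) :
  tr_subst f g -> tr_form (HAomega.subst_form f p) = subst g (tr_form p).
Proof.
  revert D f g; induction p; intros D f g H; cbn [tr_form HAomega.subst_form];
    rewrite ?subst_arrow, ?subst_prod; cbn [subst]; rewrite ?subst_tr_ty;
    f_equal; auto using tr_tm_subst, tr_subst_up.
Qed.

Lemma tr_subst_ids G : tr_subst (@HAomega.ids G) Var.
Proof. intros s x; reflexivity. Qed.

Lemma tr_form_inst G s (p : HAomega.form (s :: G)) a :
  tr_form (HAomega.inst p a) = inst (tr_form p) (tr_tm a).
Proof. apply tr_form_subst, tr_subst_scons, tr_subst_ids. Qed.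

Lemma tr_form_weak G s (p : HAomega.form G) :
  tr_form (@HAomega.weak G s p) = shift (tr_form p).
Proof. unfold shift; rewrite ren_subst; apply tr_form_subst, tr_subst_shift. Qed.

(** * The propositional axioms *)

Ltac solve_ty :=
  first
    [ assumption
    | lazymatch goal with
      | |- ty _ (arrow _ _) => apply ty_arrow
      | |- ty _ (prod _ _) => apply ty_prod
      | |- ty _ (Sum _ _) => apply t_Sum
      | |- ty _ (shift _) => apply ty_shift
      end; solve_ty ].

Ltac push_shift := rewrite ?shift_arrow, ?shift_prod, ?shift_Sum.

Lemma inh_lookup n G A B : wf G -> lookup G n A -> A = B -> inh G B.
Proof. intros W L <-; exists (Var n); apply t_var; assumption. Qed.

(** Four positions suffice: at most three introduced implications and, in [inh_ax_case], the
    assumption of a branch. *)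
Ltac solve_hyp :=
  let hyp n := solve [ eapply (inh_lookup n);
    [apply wf_ty_cons; solve_ty | repeat constructor | push_shift; reflexivity] ] in
  first [hyp 0 | hyp 1 | hyp 2 | hyp 3].

Ltac intro_arrow := apply inh_arrow_intro; [solve_ty .. |]; push_shift.

Section Propositional.

Variables (G : list term) (A B C : term).
Hypotheses (HA : ty G A) (HB : ty G B) (HC : ty G C).

Lemma inh_ax_k : inh G (arrow A (arrow B A)).
Proof. do 2 intro_arrow; solve_hyp. Qed.

Lemma inh_ax_s :
  inh G (arrow (arrow A (arrow B C)) (arrow (arrow A B) (arrow A C))).
Proof.
  do 3 intro_arrow.
  apply inh_arrow_elim with (shift (shift (shift B))); [solve_ty .. | |].
  - apply inh_arrow_elim with (shift (shift (shift A))); [solve_ty .. | |]; solve_hyp.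
  - apply inh_arrow_elim with (shift (shift (shift A))); [solve_ty .. | |]; solve_hyp.
Qed.

Lemma inh_ax_conj : inh G (arrow A (arrow B (prod A B))).
Proof. do 2 intro_arrow; apply inh_prod_intro; solve [solve_ty | solve_hyp]. Qed.

Lemma inh_ax_proj1 : inh G (arrow (prod A B) A).
Proof.
  intro_arrow; apply inh_proj1 with (shift B); solve [solve_ty | solve_hyp].
Qed.

Lemma inh_ax_proj2 : inh G (arrow (prod A B) B).
Proof.
  intro_arrow; apply inh_proj2 with (shift A); solve [solve_ty | solve_hyp].
Qed.

Lemma inh_ax_inl : inh G (arrow A (Sum A B)).
Proof. intro_arrow; apply inh_inl; solve [solve_ty | solve_hyp]. Qed.

Lemma inh_ax_inr : inh G (arrow B (Sum A B)).
Proof. intro_arrow; apply inh_inr; solve [solve_ty | solve_hyp]. Qed.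

Lemma inh_ax_case :
  inh G (arrow (arrow A C) (arrow (arrow B C) (arrow (Sum A B) C))).
Proof.
  do 3 intro_arrow.
  apply inh_sum_elim with (shift (shift (shift A))) (shift (shift (shift B)));
    [solve_ty .. | | |].
  - solve_hyp.
  - apply inh_arrow_elim with (shift (shift (shift (shift A)))); [solve_ty .. | |];
      solve_hyp.
  - apply inh_arrow_elim with (shift (shift (shift (shift B)))); [solve_ty .. | |];
      solve_hyp.
Qed.

Lemma inh_ax_efq : inh G (arrow Empty A).
Proof.
  assert (HE : ty G Empty) by (eapply t_Empty, has_type_wf, HA).
  intro_arrow; apply inh_empty_elim; [solve_ty|].
  exact (inh_var0 _ _ HE).
Qed.

End Propositional.

(** * Axioms of arithmetic and equality *)

Lemma ty_subst G D f A : ty G A -> well_subst D f G -> ty D (subst f A).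
Proof. exact (has_type_subst G A (Univ 0) D f). Qed.

(* The substitution generalizes weakening: it lets rules stated for arbitrary
   contexts be turned into implications. *)
Lemma inh_arrow_intro_subst G A B :
  ty G A -> ty G B ->
  (forall D f, well_subst D f G -> inh D (subst f A) -> inh D (subst f B)) ->
  inh G (arrow A B).
Proof.
  intros HA HB H; apply inh_arrow_intro; [exact HA | exact HB |].
  unfold shift; rewrite ren_subst; apply H.
  - apply well_subst_wk, wf_ty_cons, HA.
  - rewrite <- ren_subst; apply inh_var0, HA.
Qed.

Lemma inh_ax_all G s P a :
  ty (tr_ty s :: G) P -> has_type G a (tr_ty s) ->
  inh G (arrow (Pi (tr_ty s) P) (inst P a)).
Proof.
  intros HP Ha; assert (W := has_type_wf _ _ _ Ha).
  apply inh_arrow_intro_subst.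
  - apply t_Pi; [apply ty_tr_ty|]; assumption.
  - exact (has_type_inst _ _ _ _ _ HP Ha).
  - intros D f S H; cbn in H; rewrite subst_tr_ty in H; rewrite subst_inst.
    apply inh_pi_elim with (tr_ty s).
    + apply ty_tr_ty, S.
    + eapply ty_subst; [exact HP | apply well_subst_up_tr, S].
    + exact H.
    + eapply st_subst; eassumption.
Qed.

Lemma inh_ax_ex G s P a :
  ty (tr_ty s :: G) P -> has_type G a (tr_ty s) ->
  inh G (arrow (inst P a) (Sig (tr_ty s) P)).
Proof.
  intros HP Ha; assert (W := has_type_wf _ _ _ Ha).
  apply inh_arrow_intro_subst.
  - exact (has_type_inst _ _ _ _ _ HP Ha).
  - apply t_Sig; [apply ty_tr_ty|]; assumption.
  - intros D f S H; cbn; rewrite subst_tr_ty; rewrite subst_inst in H.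
    apply inh_sig_intro with (subst f a).
    + apply ty_tr_ty, S.
    + eapply ty_subst; [exact HP | apply well_subst_up_tr, S].
    + eapply st_subst; eassumption.
    + exact H.
Qed.

Lemma inh_ax_repl G s P a b :
  ty (tr_ty s :: G) P -> has_type G a (tr_ty s) -> has_type G b (tr_ty s) ->
  inh G (arrow (Id (tr_ty s) a b) (arrow (inst P a) (inst P b))).
Proof.
  intros HP Ha Hb; assert (W := has_type_wf _ _ _ Ha).
  assert (HPa := has_type_inst _ _ _ _ _ HP Ha : ty G (inst P a)).
  assert (HPb := has_type_inst _ _ _ _ _ HP Hb : ty G (inst P b)).
  apply inh_arrow_intro_subst; [| apply ty_arrow; assumption |].
  - apply t_Id; [apply ty_tr_ty|..]; assumption.
  - intros D f S H; rewrite subst_arrow.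
    apply inh_arrow_intro_subst; [eapply ty_subst; eassumption .. |].
    (* The second implication brings a further substitution [f'], along which the equation assumed
       first has to be carried. *)
    intros D' f' S' H'; apply (inh_subst _ _ _ _ H) in S' as H1.
    cbn in H1; rewrite !subst_tr_ty in H1.
    rewrite !subst_inst in H'; rewrite !subst_inst.
    apply inh_transport with (tr_ty s) (subst f' (subst f a));
      [ | | | | exact H1 | exact H'].
    + apply ty_tr_ty, S'.
    + eapply ty_subst; [eapply ty_subst; [exact HP|]|]; apply well_subst_up_tr;
        eassumption.
    + eapply st_subst; [eapply st_subst|]; eassumption.
    + eapply st_subst; [eapply st_subst|]; eassumption.
Qed.

Lemma tr_succ_type G n :
  has_type G n Nat -> has_type G (app (tr_const HAomega.cSucc) n) Nat.
Proof.
  intros Hn; apply (st_app _ HAomega.N HAomega.N); [|exact Hn].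
  apply tr_const_type; eapply has_type_wf, Hn.
Qed.

(* Large elimination into the universe [Univ 0] separates [succ n] from [zero]. *)
Lemma inh_succ_zero G n :
  has_type G n Nat -> inh G (Id Nat (app (tr_const HAomega.cSucc) n) zero) ->
  inh G Empty.
Proof.
  intros Hn H; assert (W := has_type_wf _ _ _ Hn).
  assert (HN : ty G Nat) by exact (t_Nat 0 W).
  assert (WN := wf_ty_cons _ _ HN).
  pose (C := natrec Empty Unit (Var 0)).
  assert (WU : forall D, wf (Nat :: D) -> wf (Univ 0 :: Nat :: D)).
  { intros D WD; econstructor; [exact WD | apply t_univ, WD]. }
  assert (HC : ty (Nat :: G) C).
  { apply has_type_eq with (inst (Univ 0) (Var 0)); [|reflexivity].
    assert (HN' := t_Nat 0 WN); assert (WNN := wf_ty_cons _ _ HN').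
    apply t_natrec with (j := 1).
    - apply t_univ, WNN.
    - apply t_Empty, WN.
    - apply t_Unit, WU, WNN.
    - apply (st_var _ _ HAomega.N); [exact WN | reflexivity]. }
  apply inh_conv with (inst C zero).
  - eapply inh_transport; [exact HN | exact HC | | | exact H |].
    + apply tr_succ_type, Hn.
    + apply t_zero, W.
    + apply inh_conv with Unit; [exists star; apply t_star, W|].
      apply c_sym; eapply c_trans.
      * apply (c_natrec (C := Univ 0) (d' := Empty) (e' := Unit) (t' := succ n)
                 (j := 1)).
        -- apply t_univ, WN.
        -- apply c_refl, t_Empty, W.
        -- apply c_refl, t_Unit, WU, WN.
        -- apply tr_succ_conv; assumption.
      * apply (c_natrec_succ (C := Univ 0) (e := Unit) (j := 1)).
        -- apply t_univ, WN.
        -- apply t_Empty, W.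
        -- apply t_Unit, WU, WN.
        -- exact Hn.
  - apply (c_natrec_zero (C := Univ 0) (j := 1)).
    + apply t_univ, WN.
    + apply t_Empty, W.
    + apply t_Unit, WU, WN.
Qed.

(** Transport in the family [n = pred x]: at the successor of [n] it converts to [n = n], at the
    successor of [m] to the goal. *)
Lemma inh_succ_inj G n m :
  has_type G n Nat -> has_type G m Nat ->
  inh G (Id Nat (app (tr_const HAomega.cSucc) n) (app (tr_const HAomega.cSucc) m)) ->
  inh G (Id Nat n m).
Proof.
  intros Hn Hm H; assert (W := has_type_wf _ _ _ Hn).
  assert (HN : ty G Nat) by exact (t_Nat 0 W).
  assert (WN := wf_ty_cons _ _ HN).
  (* Variable 1 is the number below the successor; the value [zero] at zero is a default. *)
  pose (pred := natrec zero (Var 1)).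
  assert (He : forall D, wf (Nat :: D) -> has_type (Nat :: Nat :: D) (Var 1) Nat).
  { intros D WD; apply (st_var _ _ HAomega.N);
      [apply (wf_cons_tr _ HAomega.N), WD | reflexivity]. }
  assert (Hpred : forall t, has_type G t Nat -> conv G
            (pred (app (tr_const HAomega.cSucc) t)) t Nat).
  { intros t Ht; eapply c_trans.
    - apply (st_natrec_conv G HAomega.N);
        [apply t_zero, W | apply He, WN | apply tr_succ_conv; [exact W | exact Ht]].
    - apply (st_natrec_succ G HAomega.N);
        [apply t_zero, W | apply He, WN | exact Ht | reflexivity]. }
  pose (C := Id Nat (shift n) (pred (Var 0))).
  assert (HC : ty (Nat :: G) C).
  { apply t_Id; [apply t_Nat, WN | apply (st_shift G n HAomega.N); assumption |].
    apply (st_natrec _ HAomega.N).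
    - apply t_zero, WN.
    - apply He, (wf_cons_tr _ HAomega.N), WN.
    - apply (st_var _ _ HAomega.N); [exact WN | reflexivity]. }
  assert (EC : forall t, has_type G t Nat ->
            conv G (inst C (app (tr_const HAomega.cSucc) t)) (Id Nat n t) (Univ 0)).
  { intros t Ht; apply conv_eq with
      (Id Nat n (pred (app (tr_const HAomega.cSucc) t))) (Id Nat n t) (Univ 0);
      [|subst_eq|reflexivity|reflexivity].
    apply c_Id; [apply c_refl, HN | apply c_refl, Hn | apply Hpred, Ht]. }
  apply inh_conv with (inst C (app (tr_const HAomega.cSucc) m)); [|apply EC, Hm].
  eapply inh_transport; [exact HN | exact HC | | | exact H |];
    [apply tr_succ_type; assumption .. |].
  apply inh_conv with (Id Nat n n); [|apply c_sym, EC, Hn].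
  exists (refl n); eapply t_refl; eassumption.
Qed.

(** The step of HA concludes at the translated successor applied to a variable, while [natrec]
    expects the raw [succ]. The two instances of [P] differ by a beta step, along which
    [inh_subst_conv] moves the step. *)
Lemma inh_induction G P :
  ty (Nat :: G) P -> inh G (inst P zero) ->
  inh G (Pi Nat (arrow P
    (subst (scons (app (tr_const HAomega.cSucc) (Var 0)) (fun n => Var (S n))) P))) ->
  inh G (Pi Nat P).
Proof.
  intros HP H0 HS.
  assert (WN := has_type_wf _ _ _ HP).
  assert (W : wf G) by (inversion WN; assumption).
  assert (HN : ty G Nat) by exact (t_Nat 0 W).
  assert (HNN : ty (Nat :: G) Nat) by exact (t_Nat 0 WN).
  assert (WNN := wf_ty_cons _ _ HNN).
  assert (V0 : has_type (Nat :: G) (Var 0) Nat)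
    by (apply (st_var _ _ HAomega.N); [exact WN | reflexivity]).
  assert (SW := well_subst_wk _ _ WN).
  set (PS := subst (scons (app _ _) _) P) in HS.
  assert (HPS : ty (Nat :: G) PS).
  { eapply ty_subst; [exact HP|]; apply well_subst_cons; [exact SW|].
    apply tr_succ_type, V0. }
  apply inh_pi_elim_var in HS; [|exact HN|apply ty_arrow; assumption].
  apply inh_arrow_elim_var in HS; [|assumption..].
  assert (WP := wf_ty_cons _ _ HP).
  assert (V1 : has_type (P :: Nat :: G) (Var 1) Nat)
    by (apply (st_shift (Nat :: G) (Var 0) HAomega.N); assumption).
  assert (SW2 : well_subst (P :: Nat :: G) (fun n => Var (S (S n))) G)
    by exact (well_subst_shift _ _ _ _ WP SW).
  assert (HS' : inh (P :: Nat :: G) (inst_wk2 P (succ (Var 1)))).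
  { apply inh_subst_conv with G Nat (app (tr_const HAomega.cSucc) (Var 1));
      try assumption.
    - apply tr_succ_type, V1.
    - apply t_succ, V1.
    - apply tr_succ_conv; assumption.
    - eapply inh_eq; [exact HS | unfold PS; subst_eq]. }
  (* The recursion runs on the variable that the conclusion quantifies over, so its motive lives
     beside that variable: [P] with the parameters weakened. *)
  pose (P1 := subst (up (fun n => Var (S n))) P).
  assert (SU : well_subst (Nat :: Nat :: G) (up (fun n => Var (S n))) (Nat :: G))
    by exact (well_subst_up_tr _ _ _ HAomega.N SW).
  assert (HP1 : ty (Nat :: Nat :: G) P1) by exact (ty_subst _ _ _ _ HP SU).
  apply inh_pi_intro; [exact HN | exact HP |].
  apply inh_eq with (inst P1 (Var 0)); [|unfold P1; subst_eq].
  apply inh_natrec; [exact HP1 | | | exact V0].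
  - eapply inh_eq; [exact (inh_shift _ _ _ HN H0) | unfold P1; subst_eq].
  - eapply inh_eq; [eapply inh_subst; [exact HS'|] |].
    + eapply well_subst_up; [exact SU | exact HP1].
    + unfold P1; subst_eq.
Qed.

(** There is no eta for [Sig], so [split] is used with the equation itself as motive. On a raw pair
    both projections compute and reflexivity applies. *)
Lemma inh_surjective_pairing G s t c :
  has_type G c (tr_ty (HAomega.Prd s t)) ->
  inh G (Id (tr_ty (HAomega.Prd s t))
           (app (app (tr_const (HAomega.cPair s t))
                   (app (tr_const (HAomega.cFst s t)) c))
              (app (tr_const (HAomega.cSnd s t)) c)) c).
Proof.
  intros Hc; assert (W := has_type_wf _ _ _ Hc).
  pose (eta x := app (app (tr_const (HAomega.cPair s t))
                        (app (tr_const (HAomega.cFst s t)) x))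
                   (app (tr_const (HAomega.cSnd s t)) x)).
  assert (Heta : forall D x, has_type D x (tr_ty (HAomega.Prd s t)) ->
            has_type D (eta x) (tr_ty (HAomega.Prd s t))).
  { intros D x Hx; assert (WD := has_type_wf _ _ _ Hx).
    eapply st_app; [eapply st_app|]; [apply tr_const_type, WD| |];
      (eapply st_app; [apply tr_const_type, WD | exact Hx]). }
  assert (WP := wf_cons_tr _ (HAomega.Prd s t) W).
  pose (A := tr_ty (HAomega.Prd s t)).
  assert (HA : forall D, wf D -> ty D A) by (intros; apply ty_tr_ty; assumption).
  pose (C := Id A (eta (Var 0)) (Var 0)).
  assert (Ws := wf_cons_tr _ s W).
  assert (Wst := wf_cons_tr _ t Ws).
  assert (Hd : inh (tr_ty t :: tr_ty s :: G) (Id A (eta (pair (Var 1) (Var 0)))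
                 (pair (Var 1) (Var 0)))).
  { assert (V1 : has_type (tr_ty t :: tr_ty s :: G) (Var 1) (tr_ty s))
      by (apply st_var; [exact Wst | reflexivity]).
    assert (V0 : has_type (tr_ty t :: tr_ty s :: G) (Var 0) (tr_ty t))
      by (apply st_var; [exact Wst | reflexivity]).
    apply inh_refl_conv; [apply HA, Wst | apply Heta, st_pair; assumption |].
    eapply c_trans; [|apply tr_pair_conv; assumption].
    eapply st_app_conv; [eapply st_app_conv| |];
      [apply c_refl, tr_const_type, Wst | | exact Wst | | exact Wst].
    - apply tr_fst_pair_conv; assumption.
    - apply tr_snd_pair_conv; assumption. }
  destruct Hd as [d Hd]; exists (split d c).
  apply has_type_eq with (inst C c).
  - unfold A in Hc; rewrite tr_ty_prd in Hc.
    apply t_split with (A := tr_ty s) (B := tr_ty t) (i := 0) (j := 0);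
      auto using ty_tr_ty.
    + rewrite <- tr_ty_prd; apply t_Id; [apply HA, WP | apply Heta |];
        apply st_var; try exact WP; reflexivity.
    + eapply has_type_eq; [exact Hd|].
      unfold A; rewrite <- (subst_tr_ty (scons (pair (Var 1) (Var 0))
                                 (fun n => Var (S (S n)))) (HAomega.Prd s t)).
      reflexivity.
  - rewrite <- (subst_tr_ty (scons c Var) (HAomega.Prd s t)) at 1; reflexivity.
Qed.

(** * Soundness of the axioms and of the inference rules *)

Lemma axiom_sound G (p : HAomega.form G) :
  HAomega.axiom p -> inh (tr_ctx G) (tr_form p).
Proof.
  assert (W := wf_tr_ctx G).
  intros H; destruct H; cbn [tr_form]; rewrite ?tr_form_inst;
    lazymatch goal with
    | |- inh _ (Id _ _ _) => idtac
    | |- _ =>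
        (* Collects the typings of the formulas occurring in the axiom, which the lemmas applied
           below take as hypotheses. *)
        repeat match goal with q : HAomega.form _ |- _ =>
          lazymatch goal with
          | _ : has_type _ (tr_form q) _ |- _ => fail
          | _ => pose proof (tr_form_type _ q)
          end end
    end.
  - apply inh_ax_k; assumption.
  - apply inh_ax_s; assumption.
  - apply inh_ax_conj; assumption.
  - apply inh_ax_proj1; assumption.
  - apply inh_ax_proj2; assumption.
  - apply inh_ax_inl; assumption.
  - apply inh_ax_inr; assumption.
  - apply inh_ax_case; assumption.
  - apply inh_ax_efq; assumption.
  - apply inh_ax_all; [assumption | apply tr_tm_type].
  - apply inh_ax_ex; [assumption | apply tr_tm_type].
  - exists (refl (tr_tm a)); eapply t_refl; [apply ty_tr_ty, W | apply tr_tm_type].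
  - apply inh_ax_repl; [assumption | apply tr_tm_type ..].
  - assert (HE := t_Empty 0 W).
    assert (HI := tr_form_type _ (HAomega.Eq (HAomega.succ a) HAomega.zero)).
    apply inh_arrow_intro_subst; [exact HI | exact HE |].
    intros D f S; apply inh_succ_zero.
    apply (st_subst _ _ _ _ HAomega.N) with (2 := S), tr_tm_type.
  - assert (HI := tr_form_type _ (HAomega.Eq (HAomega.succ a) (HAomega.succ b))).
    assert (HI' := tr_form_type _ (HAomega.Eq a b)).
    apply inh_arrow_intro_subst; [exact HI | exact HI' |].
    intros D f S; apply inh_succ_inj;
      apply (st_subst _ _ _ _ HAomega.N) with (2 := S), tr_tm_type.
  - assert (HN : ty (tr_ctx G) Nat) by exact (t_Nat 0 W).
    unfold HAomega.inst_succ.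
    rewrite (tr_form_subst _ _ _ _ _ (tr_subst_scons _ _ _
      (HAomega.succ (HAomega.Var HAomega.vz)) _ _ (tr_subst_shift G HAomega.N))).
    set (PS := subst _ _).
    assert (HPS : ty (Nat :: tr_ctx G) PS).
    { eapply ty_subst; [eassumption|]; apply well_subst_cons.
      - apply well_subst_wk, wf_ty_cons, HN.
      - apply tr_succ_type, (st_var _ _ HAomega.N);
          [apply wf_ty_cons, HN | reflexivity]. }
    assert (H0 : ty (tr_ctx G) (inst (tr_form p) zero))
      by exact (has_type_inst _ _ _ _ _ H (t_zero W)).
    assert (HS : ty (tr_ctx G) (Pi Nat (arrow (tr_form p) PS)))
      by (apply t_Pi; [|apply ty_arrow]; assumption).
    apply inh_arrow_intro_subst;
      [apply ty_prod; assumption | apply t_Pi; assumption |].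
    intros D f S HD; rewrite subst_prod in HD.
    assert (H0' := ty_subst _ _ _ _ H0 S); assert (HS' := ty_subst _ _ _ _ HS S).
    apply inh_induction.
    + eapply ty_subst; [exact H | exact (well_subst_up_tr _ _ _ HAomega.N S)].
    + rewrite <- (subst_inst f _ zero).
      eapply inh_proj1; eassumption.
    + eapply inh_eq; [eapply inh_proj2; [exact H0' | exact HS' | exact HD] |].
      unfold PS; subst_eq.
  - apply inh_refl_conv; [apply ty_tr_ty, W | exact (tr_tm_type _ _ _) |].
    apply tr_rec_zero_conv; [exact W | apply tr_tm_type ..].
  - apply inh_refl_conv; [apply ty_tr_ty, W | apply tr_tm_type |].
    apply tr_rec_succ_conv; [exact W | apply tr_tm_type ..].
  - apply inh_refl_conv; [apply ty_tr_ty, W | apply tr_tm_type |].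
    apply tr_fst_conv; [exact W | apply tr_tm_type ..].
  - apply inh_refl_conv; [apply ty_tr_ty, W | apply tr_tm_type |].
    apply tr_snd_conv; [exact W | apply tr_tm_type ..].
  - apply inh_surjective_pairing, tr_tm_type.
  - apply inh_refl_conv; [apply ty_tr_ty, W | apply tr_tm_type |].
    apply tr_K_conv; [exact W | apply tr_tm_type ..].
  - apply inh_refl_conv; [apply ty_tr_ty, W | apply tr_tm_type |].
    apply tr_S_conv; [exact W | apply tr_tm_type ..].
Qed.

(** In the premise the bound variable precedes the hypothesis [Q], in the conclusion it follows it.
    Instead of an exchange lemma, the premise is pulled back along [up f], where the target of [f]
    already provides [Q]. *)
Lemma rule_all_sound G s Q P :
  ty G Q -> ty (tr_ty s :: G) P -> inh (tr_ty s :: G) (arrow (shift Q) P) ->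
  inh G (arrow Q (Pi (tr_ty s) P)).
Proof.
  intros HQ HP H; assert (W := has_type_wf _ _ _ HQ).
  apply inh_arrow_intro_subst;
    [exact HQ | apply t_Pi; [apply ty_tr_ty, W | exact HP] |].
  intros D f S HD; cbn; rewrite subst_tr_ty.
  assert (SU := well_subst_up_tr _ _ _ s S).
  assert (HT := ty_tr_ty _ s (proj1 S)).
  assert (HP' := ty_subst _ _ _ _ HP SU).
  apply inh_pi_intro; [exact HT | exact HP' |].
  apply inh_subst with (1 := H) in SU.
  rewrite subst_arrow, subst_shift in SU.
  eapply inh_arrow_elim; [| exact HP' | exact SU | apply inh_shift; assumption].
  apply ty_shift; [exact HT | eapply ty_subst; eassumption].
Qed.

Lemma rule_ex_sound G s P Q :
  ty G Q -> ty (tr_ty s :: G) P -> inh (tr_ty s :: G) (arrow P (shift Q)) ->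
  inh G (arrow (Sig (tr_ty s) P) Q).
Proof.
  intros HQ HP H; assert (W := has_type_wf _ _ _ HQ).
  apply inh_arrow_intro_subst;
    [apply t_Sig; [apply ty_tr_ty, W | exact HP] | exact HQ |].
  intros D f S HD; cbn in HD; rewrite subst_tr_ty in HD.
  assert (SU := well_subst_up_tr _ _ _ s S).
  assert (HT := ty_tr_ty _ s (proj1 S)).
  assert (HP' := ty_subst _ _ _ _ HP SU).
  assert (HQ' := ty_subst _ _ _ _ HQ S).
  apply inh_subst with (1 := H) in SU.
  rewrite subst_arrow, subst_shift in SU.
  eapply inh_sig_elim; [exact HT | exact HP' | exact HQ' | exact HD |].
  apply inh_arrow_elim_var; [exact HP' | apply ty_shift; assumption | exact SU].
Qed.

Lemma rule_iRC_sound G (p : HAomega.form (HAomega.N :: HAomega.N :: G)) :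
  inh (tr_ctx G) (tr_form (HAomega.All HAomega.N (HAomega.ExUnique p))) ->
  inh (tr_ctx G)
    (tr_form (HAomega.Ex (HAomega.Arr HAomega.N HAomega.N) (HAomega.AllApp p))).
Proof.
  intros H.
  assert (HN := t_Nat 0 (wf_tr_ctx G) : ty (tr_ctx G) Nat).
  assert (HNN := t_Nat 0 (wf_ty_cons _ _ HN)).
  assert (HP := tr_form_type _ p).
  assert (HE := tr_form_type _ (HAomega.ExUnique p)).
  unfold HAomega.ExUnique in H, HE; cbv zeta in H, HE.
  match type of H with context [HAomega.And _ ?u] =>
    assert (HU := tr_form_type _ u); set (U := u) in * end.
  assert (HEx := tr_form_type _ (HAomega.Ex HAomega.N p)).
  (* The conjunction sits below the quantifier: [H] is opened at the variable, projected to its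
     existence part and closed again, which gives the premise of [inh_choice]. *)
  apply inh_pi_elim_var in H; [|exact HN|exact HE].
  apply inh_proj1 in H; [|exact HEx|exact HU].
  apply inh_pi_intro in H; [|exact HN|exact HEx].
  apply inh_choice in H; [|exact HN|exact HNN|exact HP].
  eapply inh_eq; [exact H|].
  cbn [tr_form]; unfold HAomega.AllApp; cbn [tr_form].
  (* The substitution in [AllApp] matches the one in the conclusion of [inh_choice]: the function
     applied to x is put for y, and the parameters skip x and the function. *)
  erewrite tr_form_subst; [reflexivity|].
  apply (tr_subst_scons _ _ _ 
    (HAomega.App (HAomega.Var (HAomega.vs HAomega.vz)) (HAomega.Var HAomega.vz))).
  apply (tr_subst_scons _ _ _ (HAomega.Var HAomega.vz)).
  intros s x; reflexivity.
Qed.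

Theorem proposition5p2 :
  forall (G : list HAomega.fty) (phi : HAomega.form G),
    HAomega.derivable_iRC phi ->
    exists t : MLTT.term, MLTT.has_type (tr_ctx G) t (tr_form phi).
Proof.
  intros G phi H.
  change (inh (tr_ctx G) (tr_form phi)).
  induction H as [G p H | G p q _ IHi _ IHp | G s q p _ IH | G s p q _ IH | G p _ IH].
  - apply axiom_sound, H.
  - eapply inh_arrow_elim; [apply tr_form_type .. | exact IHi | exact IHp].
  - apply rule_all_sound; [apply tr_form_type | exact (tr_form_type _ p) |].
    rewrite <- (tr_form_weak _ s); exact IH.
  - apply rule_ex_sound; [apply tr_form_type | exact (tr_form_type _ p) |].
    rewrite <- (tr_form_weak _ s); exact IH.
  - apply rule_iRC_sound, IH.
Qed.
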